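(* Fix an integer $d\ge 2$. There is a sequence $(\varepsilon_n)_{n\ge 1}$ with $\varepsilon_n = o(1)$ such that the following holds: for $t = (1+\varepsilon_n)\, n\log n/2$ and $b = (1+\varepsilon_n)\, dn/2$, there exists a $(t,b)$-strategy of Builder such that $G_t$ is $d$-connected asymptotically almost surely (i.e. with probability tending to $1$ as $n\to\infty$).
   Context: Model: the edges of the complete graph $K_n$ are ordered uniformly at random and revealed one per round to a player called Builder, who starts with the empty graph on $V(K_n)$. At each round Builder must decide (based only on the sequence of edges proposed so far) whether to accept the currently proposed edge. For $s\ge 0$, $G_s$ denotes the graph of all edges accepted by Builder during the first $s$ rounds. A strategy of Builder is a (possibly random) function which, given $s\le\binom n2$ and an $s$-tuple $(e_1,\dots,e_s)$ of distinct edges of $K_n$, outputs $1$ if Builder accepts $e_s$ at round $s$ (given that $e_1,\dots,e_{s-1}$ were proposed before, in this order) and $0$ otherwise. A $(t,b)$-strategy is a strategy that, for every $s\le t$, decides whether to accept the edge of round $s$ under the constraint $|E(G_s)|\le b$. A graph $G$ is $d$-connected if $|V(G)|\ge d+1$ and removing any set of at most $d-1$ vertices leaves a connected graph. *)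

(* Defs.v *)
From HB Require Import structures.
From mathcomp Require Import all_boot all_order all_algebra.
From mathcomp Require Import all_classical all_reals all_analysis.

Set Implicit Arguments.
Unset Strict Implicit.
Unset Printing Implicit Defensive.

Import Order.TTheory GRing.Theory Num.Theory.
Import numFieldNormedType.Exports.

Local Open Scope ring_scope.

(** * Connectivity of finite graphs *)

Definition connected_on (T : finType) (e : rel T) (A : {set T}) : bool :=
  [forall x in A, forall y in A,
     connect [rel u v | [&& u \in A, v \in A & e u v]] x y].

Definition d_connected (T : finType) (d : nat) (e : rel T) : bool :=
  (d.+1 <= #|T|)%N &&
  [forall S : {set T}, (#|S| < d)%N ==> connected_on e (~: S)].

(** * The edge process on the complete graph *)

Definition edge (n : nat) : finType := {e : {set 'I_n} | (#|e| == 2)%N}.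

Definition adj (n : nat) (E : {set edge n}) : rel 'I_n :=
  [rel x y | [exists e in E, val e == [set x; y]]].

Definition orders (n : nat) : {set #|edge n|.-tuple (edge n)} :=
  [set o : #|edge n|.-tuple (edge n) | uniq o].

(** * Builder *)

(* A random function is a family of functions indexed by a seed drawn from an
   arbitrary probability space. [decision w [:: e_1; ...; e_s]] tells whether
   [e_s] is accepted at round [s] after [e_1, ..., e_(s-1)] were proposed; its
   values on the empty sequence and on sequences with repetitions are never
   used. *)
Record strategy (R : realType) (n : nat) := Strategy {
  seed_display : measure_display;
  seed : measurableType seed_display;
  seed_law : probability seed R;
  decision : seed -> seq (edge n) -> bool;
  measurable_decision :
    forall es : seq (edge n), measurable [set w | decision w es]%classic
}.

(* [E(G_s)]: an edge of the order [o] is proposed at round [(index e o).+1]. *)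
Definition accepted (n : nat) (f : seq (edge n) -> bool)
    (o : seq (edge n)) (s : nat) : {set edge n} :=
  [set e in take s o | f (take (index e o).+1 o)].

(* The parameters [t] and [b] are real numbers, not necessarily integers. The
   budget is a hard constraint, for all seeds and all orders. *)
Definition is_tb_strategy (R : realType) (n : nat) (t b : R)
    (sigma : strategy R n) : Prop :=
  forall (w : seed sigma) (o : #|edge n|.-tuple (edge n)) (s : nat),
    o \in orders n -> s%:R <= t ->
    #|accepted (decision w) o s|%:R <= b.

(* Probability of the event that the graph after [s] rounds satisfies [Q], under
   the product of the seed law and the uniform law on the orders: the order is
   independent of the randomness used by Builder. *)
Definition prob_graph (R : realType) (n : nat) (sigma : strategy R n) (s : nat)
    (Q : rel 'I_n -> bool) : R :=
  (\sum_(o in orders n)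
     fine (seed_law sigma
       [set w | Q (adj (accepted (decision w) o s))]%classic))
  / #|orders n|%:R.

(* Main.v *)
Require Import Defs.
From HB Require Import structures.
From mathcomp Require Import all_classical all_reals all_analysis.
From mathcomp Require Import all_boot all_order all_algebra.
From mathcomp Require Import perm zify ring lra.

Set Implicit Arguments.
Unset Strict Implicit.
Unset Printing Implicit Defensive.

Import Order.TTheory GRing.Theory Num.Theory.
Import numFieldNormedType.Exports.

(* Builder works in four phases. The vertices are cut into [2 m + 1] layers of equal
   size, where [m] is a large constant.
   1. For [O(n)] rounds all edges inside layer 0 are accepted. Disjoint sets of
      linear size are joined by an edge, so most of layer 0 spans a [d]-connected
      core.
   2. For [eta n log n] rounds, consecutive layers of two chains of layers are
      joined greedily so that a vertex gets [d/2] (rounded down) edges up and down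
      its chain, plus one edge to the other chain if [d] is odd; the end layers of
      the chains are attached to the core by [d] edges. Only a small fraction of
      the vertices is left with unmet demands.
   3. For [eta n log n] more rounds, all vertices at distance at most [r] from the
      unsatisfied ones are attached to the core. A vertex fails with probability
      [n^-c], so for [r] large there is no path of [r + 1] failing vertices: the
      failing vertices reachable from unsatisfied ones are separated from the rest
      of the chains by vertices attached to the core.
   4. In the remaining [(1 + o(1)) n log n / 2] rounds every vertex that is not yet
      in the structure takes [d] edges to it.
   The result is [d]-connected because every nonempty set [X] outside the core has
   at least [d] neighbours: the highest and the lowest vertex of [X] in a chain see
   [d/2] vertices above and [d/2] vertices below [X], and if [d] is odd then a side
   edge leaves [X] unless [X] meets both chains, where it has [4 (d/2)] such vertices.
   A diagonal choice turns a fixed [eps] into a sequence tending to 0. *)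

(** * Connectivity *)

Section Connectivity.
Variables (T : finType) (d : nat) (e : rel T).
Hypothesis e_sym : symmetric e.

Definition bnd (X : {set T}) := [set y | (y \notin X) && [exists x in X, e x y]].

Definition kconn (C : {set T}) :=
  [forall S : {set T}, (#|S| < d) ==> connected_on e (C :\: S)].

Lemma connected_on_cut (A : {set T}) :
  (forall X : {set T}, X \subset A -> X != set0 -> A :\: X != set0 ->
     exists x y, [/\ x \in X, y \in A :\: X & e x y]) ->
  connected_on e A.
Proof.
move=> cutA; apply/forall_inP => x xA; apply/forall_inP => y yA.
set r := [rel _ _ | _]; apply: contraT => nxy.
pose X := [set z in A | connect r x z].
have [|||u [v [uX vAX euv]]] := cutA X.
- by apply/subsetP => z; rewrite inE => /andP[].
- by apply/set0Pn; exists x; rewrite inE xA connect0.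
- by apply/set0Pn; exists y; rewrite !inE yA (negbTE nxy).
move: uX vAX; rewrite !inE => /andP[uA xu] /andP[/negP nv vA]; case: nv.
by rewrite vA (connect_trans xu) // connect1 //= uA vA.
Qed.

Lemma connected_on_edge (A X : {set T}) :
  connected_on e A -> X \subset A -> X != set0 -> A :\: X != set0 ->
  exists x y, [/\ x \in X, y \in A :\: X & e x y].
Proof.
move=> cA XA /set0Pn[x xX] /set0Pn[y]; rewrite inE => /andP[yX yA].
have xA := subsetP XA _ xX.
have /connectP[p] := forall_inP (forall_inP cA _ xA) _ yA.
elim: p x xX {xA} => [|z p IH] x xX /=; first by move=> _ eyx; rewrite eyx xX in yX.
case/andP => /and3P[xA zA exz] pth ly.
have [zX|zX] := boolP (z \in X); first exact: (IH z).
by exists x, z; rewrite inE zX zA.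
Qed.

(* A component of [W :\: S] that misses [C] is a set [X] whose neighbours in
   [W] all lie in [S]. *)
Lemma kconn_grow (C W : {set T}) :
  C \subset W -> kconn C ->
  (forall X : {set T}, X \subset W :\: C -> X != set0 -> d <= #|bnd X :&: W|) ->
  kconn W.
Proof.
move=> CW kC expX; apply/forallP => S; apply/implyP => Sd.
have touch (X : {set T}) : X \subset W :\: S -> X != set0 ->
    (forall x y, x \in X -> y \in (W :\: S) :\: X -> ~~ e x y) ->
    X :&: C != set0.
  move=> XW X0 nX; apply: contraL Sd => /eqP XC; rewrite -leqNgt.
  apply: leq_trans (expX X _ X0) (subset_leq_card _).
    apply/subsetP => x xX; have := subsetP XW x xX.
    rewrite !inE => /andP[_ ->]; rewrite andbT; apply/negP => xC.
    by have := in_set0 x; rewrite -XC inE xX xC.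
  apply/subsetP => y; rewrite !inE => /andP[/andP[yX /exists_inP[x xX exy]] yW].
  by apply: contraT => yS; have := nX x y xX; rewrite !inE yX yS yW exy => /(_ isT).
apply: connected_on_cut => X XW X0 Y0.
apply: contrapT => nX.
have nX1 x y : x \in X -> y \in (W :\: S) :\: X -> ~~ e x y.
  by move=> xX yY; apply/negP => exy; apply: nX; exists x, y.
have XC := touch X XW X0 nX1.
have YC : ((W :\: S) :\: X) :&: C != set0.
  apply: touch => //; first exact: subsetDl.
  move=> x y xY; rewrite !inE negb_and negbK => /andP[/orP[yX _|/negP//]].
  by rewrite e_sym nX1.
have cC := implyP (forallP kC S) Sd.
have [||| x [y [xX yC exy]]] := @connected_on_edge (C :\: S) (X :&: C) cC.
- apply/subsetP => x; rewrite !inE => /andP[xX ->].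
  by have := subsetP XW x xX; rewrite inE => /andP[->].
- exact: XC.
- case/set0Pn: YC => y; rewrite !inE => /andP[/andP[yX /andP[yS yW]] yC].
  by apply/set0Pn; exists y; rewrite !inE yC yS (negbTE yX).
move: xX; rewrite inE => /andP[xX xC].
move: yC; rewrite !inE negb_and => /andP[/orP[yX|/negP nyC] /andP[yS yC]] //.
apply: nX; exists x, y; split=> //; rewrite !inE yX yS /=; exact: (subsetP CW).
Qed.

(* Removing a maximal set of at most [y] vertices with few neighbours leaves a
   set in which small sets expand. *)
Lemma expander_core (U : {set T}) (y : nat) :
  0 < d -> 0 < y -> (2 * d + 3) * y <= #|U| ->
  (forall Y1 Y2 : {set T}, Y1 \subset U -> Y2 \subset U -> [disjoint Y1 & Y2] ->
     y <= #|Y1| -> y <= #|Y2| -> exists x z, [/\ x \in Y1, z \in Y2 & e x z]) ->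
  exists C : {set T}, [/\ C \subset U, #|U| - y <= #|C| & kconn C].
Proof.
move=> d0 y0 Uy exU.
pose P (Z : {set T}) := [&& Z \subset U, #|Z| <= y & #|bnd Z :&: U| <= d * #|Z|].
have P0 : P set0.
  rewrite /P sub0set cards0 muln0 leqn0 cards_eq0; apply/eqP/setP => z.
  by rewrite !inE; apply/negP => /andP[/exists_inP[x]]; rewrite inE.
case: (@arg_maxnP _ set0 P (fun Z => #|Z|) P0) => Z /and3P[ZU Zy Zb] Zmax.
have expC (X : {set T}) : X \subset U :\: Z -> X != set0 -> #|X| <= y ->
    d <= #|bnd X :&: (U :\: Z)|.
  move=> XU X0 Xy; rewrite leqNgt; apply/negP => small.
  have X1 : 0 < #|X| by rewrite card_gt0.
  have XZ : #|Z :|: X| = #|Z| + #|X|.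
    rewrite cardsU; suff -> : Z :&: X = set0 by rewrite cards0 subn0.
    apply/setP => x; rewrite !inE; apply/negP => /andP[xZ xX].
    by have := subsetP XU x xX; rewrite inE xZ.
  have ZXU : Z :|: X \subset U.
    by rewrite subUset ZU (subset_trans XU) // subsetDl.
  have bZX : #|bnd (Z :|: X) :&: U| <= d * #|Z :|: X|.
    rewrite XZ mulnDr; apply: leq_trans (leq_add Zb (_ : #|bnd X :&: (U :\: Z)| <= _)).
      apply: leq_trans (leq_card_setU _ _); apply: subset_leq_card.
      apply/subsetP => v; rewrite !inE negb_or => /andP[/andP[/andP[vZ vX]]].
      case/exists_inP => u; rewrite inE => /orP[uZ|uX] euv vU.
        by rewrite vZ vU andbT /=; apply/orP; left; apply/exists_inP; exists u.
      by rewrite vZ vU vX andbT /=; apply/orP; right; apply/andP; split=> //;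
        apply/exists_inP; exists u.
    by apply: leq_trans (ltnW small) _; rewrite leq_pmulr.
  have big : y < #|Z :|: X|.
    rewrite ltnNge; apply/negP => small2.
    have := Zmax (Z :|: X); rewrite /P ZXU small2 bZX => /(_ isT).
    by rewrite XZ; lia.
  pose Y2 := (U :\: (Z :|: X)) :\: bnd (Z :|: X).
  have [||||| x [z [xZX zY exz]]] := exU (Z :|: X) Y2; rewrite ?ZXU ?(ltnW big) //.
  - by apply: subset_trans (subsetDl _ _) (subsetDl _ _).
  - rewrite disjoints_subset; apply/subsetP => x xZX.
    by rewrite in_setC /Y2 2!in_setD xZX andbF.
  - have h1 : #|U :\: (Z :|: X)| = #|U| - #|Z :|: X| by rewrite cardsD (setIidPr ZXU).
    have h2 : #|(U :\: (Z :|: X)) :&: bnd (Z :|: X)| <= #|bnd (Z :|: X) :&: U|.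
      rewrite setIC; apply: subset_leq_card; apply: setIS; exact: subsetDl.
    have h3 : d * #|Z :|: X| <= d * (2 * y) by rewrite leq_mul2l XZ; apply/orP; right; lia.
    by rewrite /Y2 cardsD h1; nia.
  move: zY; rewrite /Y2 !inE => /andP[/negP nz /andP[zZX _]]; apply: nz.
  by rewrite zZX; apply/exists_inP; exists x.
exists (U :\: Z); split.
- exact: subsetDl.
- by rewrite cardsD (setIidPr ZU) leq_sub2l.
apply/forallP => S; apply/implyP => Sd; apply: connected_on_cut => X XA X0 Y0.
apply: contrapT => nX.
have nX1 x z : x \in X -> z \in ((U :\: Z) :\: S) :\: X -> ~~ e x z.
  by move=> xX yY; apply/negP => exy; apply: nX; exists x, z.
set A := (U :\: Z) :\: S in XA Y0 nX nX1.
have AU : A \subset U :\: Z by exact: subsetDl.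
have smallX (X1 : {set T}) : X1 \subset A -> X1 != set0 ->
    (forall x z, x \in X1 -> z \in A :\: X1 -> ~~ e x z) -> y < #|X1|.
  move=> XA1 X10 nX2; rewrite ltnNge; apply: contraL Sd => X1y; rewrite -leqNgt.
  apply: leq_trans (expC X1 (subset_trans XA1 AU) X10 X1y) (subset_leq_card _).
  apply/subsetP => v; rewrite 2!inE => /andP[/andP[vX /exists_inP[x xX exv]] vUZ].
  apply: contraT => vS; have := nX2 x v xX; rewrite exv; apply; rewrite in_setD vX.
  by rewrite /A in_setD vS.
have [|||||x [z [xX zY exz]]] := exU X (A :\: X).
- by rewrite (subset_trans XA) // (subset_trans AU) // subsetDl.
- by rewrite (subset_trans (subsetDl _ _)) // (subset_trans AU) // subsetDl.
- rewrite disjoints_subset; apply/subsetP => x xZX.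
  by rewrite !inE xZX.
- exact/ltnW/smallX.
- apply/ltnW/smallX => //; first exact: subsetDl.
  move=> x z; rewrite in_setD => /andP[xX xA]; rewrite in_setD => /andP[zX zA].
  rewrite e_sym; apply: nX1; last by rewrite in_setD xX.
  by move: zX; rewrite in_setD zA andbT negbK.
by apply: nX; exists x, z.
Qed.

End Connectivity.

(** * Uniform orders of the edges *)

Section RandomOrder.
Local Open Scope ring_scope.
Variables (R : realType) (n : nat).
Local Notation E := (edge n).
Local Notation N := #|E|.

Definition Ex (g : seq E -> R) : R := (\sum_(o in orders n) g o) / #|orders n|%:R.
Definition Pr (P : pred (seq E)) : R := Ex (fun o => (P o)%:R).

Lemma card_orders_gt0 : (0 < #|orders n|)%N.
Proof.
have sz : size (enum E) == N by rewrite -cardE.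
by apply/card_gt0P; exists (Tuple sz); rewrite inE /= enum_uniq.
Qed.

Let O0 : (0 : R) < #|orders n|%:R.
Proof. by rewrite ltr0n card_orders_gt0. Qed.

Lemma Ex_le (g h : seq E -> R) :
  (forall o : N.-tuple E, uniq o -> g o <= h o) -> Ex g <= Ex h.
Proof.
move=> gh; rewrite ler_pM2r ?invr_gt0 //; apply: ler_sum => o; rewrite inE; exact: gh.
Qed.

Lemma Ex_cst (c : R) : Ex (fun=> c) = c.
Proof. by rewrite /Ex sumr_const -[c *+ _]mulr_natr mulfK // gt_eqF. Qed.

Lemma ExZ (c : R) (g : seq E -> R) : Ex (fun o => c * g o) = c * Ex g.
Proof. by rewrite /Ex -mulr_sumr mulrA. Qed.

Lemma ExD (g h : seq E -> R) : Ex (fun o => g o + h o) = Ex g + Ex h.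
Proof. by rewrite /Ex big_split mulrDl. Qed.

Lemma Ex_sum (I : finType) (A : {pred I}) (g : I -> seq E -> R) :
  Ex (fun o => \sum_(i in A) g i o) = \sum_(i in A) Ex (g i).
Proof. by rewrite /Ex exchange_big /= mulr_suml. Qed.

Lemma Pr_le1 (P : pred (seq E)) : Pr P <= 1.
Proof. by rewrite -[leRHS]Ex_cst; apply: Ex_le => o _; case: (P o). Qed.

Lemma Pr_sub (P Q : pred (seq E)) :
  (forall o : N.-tuple E, uniq o -> P o -> Q o) -> Pr P <= Pr Q.
Proof.
move=> PQ; apply: Ex_le => o uo; rewrite ler_nat.
by case: (P o) (PQ o uo) => // ->.
Qed.

Lemma PrC (P : pred (seq E)) : Pr (predC P) = 1 - Pr P.
Proof.
rewrite -[X in X - _](Ex_cst 1) /Pr /Ex -mulrBl -sumrB; congr (_ / _).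
by apply: eq_bigr => o _ /=; case: (P o); rewrite ?subrr ?subr0.
Qed.

Lemma Pr_or (P Q : pred (seq E)) : Pr (predU P Q) <= Pr P + Pr Q.
Proof.
rewrite -ExD; apply: Ex_le => o _ /=.
by case: (P o); case: (Q o); rewrite /= ?addr0 ?add0r ?lexx // lerDl.
Qed.

Lemma Pr_exists (I : finType) (A : {pred I}) (P : I -> pred (seq E)) (c : R) :
  (forall i, i \in A -> Pr (P i) <= c) ->
  Pr (fun o => [exists i in A, P i o]) <= #|A|%:R * c.
Proof.
move=> Pc; apply: (@le_trans _ _ (\sum_(i in A) Pr (P i))); last first.
  by rewrite mulr_natl -sumr_const; exact: ler_sum.
rewrite -Ex_sum; apply: Ex_le => o _.
have [/exists_inP[i iA Pi]|_] := boolP [exists i in A, P i o].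
  by rewrite (bigD1 i) //= Pi lerDl sumr_ge0.
by rewrite sumr_ge0.
Qed.

Lemma tnth_in_take (o : N.-tuple E) (s : nat) (j : 'I_N) :
  uniq o -> (tnth o j \in take s o) = (j < s)%N.
Proof.
move=> uo; rewrite in_take ?mem_tnth // (tnth_nth (tnth o j)) index_uniq //.
by rewrite size_tuple.
Qed.

(* The next edge is uniform among the remaining ones: transposing rounds [s] and
   [j >= s] preserves the law of the order. *)
Lemma Ex_next (g : seq E -> R) (s : nat) : (s < N)%N ->
  Ex (fun o => g (take s.+1 o)) * (N - s)%:R =
  Ex (fun o => \sum_(e | e \notin take s o) g (rcons (take s o) e)).
Proof.
move=> sN; rewrite /Ex mulrAC; congr (_ / _).
pose i0 := Ordinal sN.
have swap (j : 'I_N) : (s <= j)%N ->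
    \sum_(o in orders n) g (take s.+1 o) =
    \sum_(o in orders n) g (rcons (take s o) (tnth o j)).
  move=> sj; pose phi (o : N.-tuple E) := [tuple tnth o (tperm i0 j i) | i < N].
  have phiK : involutive phi.
    by move=> o; apply: eq_from_tnth => i; rewrite !tnth_mktuple tpermK.
  have phi_uniq o : uniq (phi o) = uniq o.
    have up (o' : N.-tuple E) : uniq o' -> uniq (phi o').
      move=> /tuple_uniqP uo'; apply/tuple_uniqP => i k.
      by rewrite !tnth_mktuple => /uo' /perm_inj.
    by apply/idP/idP => [/up|/up //]; rewrite phiK.
  rewrite (reindex_inj (inv_inj phiK)); apply: eq_big => [p|o _].
    by rewrite !inE phi_uniq.
  congr g; rewrite (take_nth (tnth o i0)) ?size_tuple //.
  have nphi x0 k (kN : (k < N)%N) :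
      nth x0 (phi o) k = tnth o (tperm i0 j (Ordinal kN)).
    have -> : nth x0 (phi o) k = tnth (phi o) (Ordinal kN) by rewrite (tnth_nth x0).
    by rewrite /phi tnth_mktuple.
  congr rcons; last by rewrite (nphi _ s sN) tpermL.
  apply: (@eq_from_nth _ (tnth o i0)); first by rewrite !size_take !size_tuple.
  move=> k; rewrite size_take size_tuple sN => ks.
  have kN := ltn_trans ks sN.
  rewrite !nth_take // (nphi _ k kN) tpermD; first by move: (tnth o i0) => x0; rewrite (tnth_nth x0).
    by apply/eqP => /(congr1 val) /= sk; rewrite sk ltnn in ks.
  by apply/eqP => /(congr1 val) /= jk; rewrite -jk ltnNge sj in ks.
have -> : (N - s)%N = #|[pred j : 'I_N | s <= j]%N|.
  have -> : #|[pred j : 'I_N | s <= j]%N| = (\sum_(j < N | s <= j) 1)%N by rewrite -sum1_card.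
  rewrite -(big_mkord (fun j => s <= j)%N (fun=> 1%N)).
  rewrite (@big_cat_nat _ _ _ s) ?(ltnW sN) //= big_nat_cond big1 => [|j]; last first.
    by case/andP => /andP[_ js]; rewrite leqNgt js.
  rewrite add0n big_nat_cond (eq_bigl (fun j => s <= j < N)%N) => [|j].
    by rewrite -big_nat sum_nat_const_nat muln1.
  by case: (s <= j)%N; rewrite ?andbT ?andbF.
rewrite mulr_natr -sumr_const (eq_bigr _ (fun j (sj : _) => swap j sj)).
rewrite exchange_big /=; apply: eq_bigr => o; rewrite inE => uo.
have tbij : bijective (tnth o).
  by apply: inj_card_bij; [exact/tuple_uniqP|rewrite card_ord].
rewrite [RHS](reindex (tnth o)) /=; last exact: onW_bij.
by apply: eq_bigl => j; rewrite tnth_in_take // -leqNgt.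
Qed.

Lemma Ex_supermartingale (g : seq E -> R) (rho : R) (s0 s1 : nat) :
  (s0 <= s1)%N -> (s1 <= N)%N -> 0 <= rho ->
  (forall h : seq E, uniq h -> (s0 <= size h < s1)%N ->
     \sum_(e | e \notin h) g (rcons h e) <= rho * (N - size h)%:R * g h) ->
  Ex (fun o => g (take s1 o)) <= rho ^+ (s1 - s0) * Ex (fun o => g (take s0 o)).
Proof.
move=> s01 s1N rho0; elim: s1 s01 s1N => [|s IH].
  by rewrite leqn0 => /eqP -> _ _; rewrite subnn expr0 mul1r.
rewrite leq_eqVlt => /orP[/eqP <- _ _|s0s sN gh].
  by rewrite subnn expr0 mul1r.
have N0 : (0 : R) < (N - s)%:R by rewrite ltr0n subn_gt0.
rewrite -(ler_pM2r N0) Ex_next //.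
apply: (@le_trans _ _ (rho * (N - s)%:R * Ex (fun o => g (take s o)))).
  rewrite -ExZ; apply: Ex_le => o uo.
  have sz : size (take s o) = s by rewrite size_take size_tuple sN.
  by rewrite -{3}sz; apply: gh; rewrite ?take_uniq // sz -ltnS s0s /=.
have {}IH : Ex (fun o => g (take s o)) <= rho ^+ (s - s0) * Ex (fun o => g (take s0 o)).
  apply: IH => //; first exact: ltnW.
  by move=> h uh /andP[h0 hs]; apply: gh => //; rewrite h0 ltnS ltnW.
apply: le_trans (ler_wpM2l _ IH) _; first by rewrite mulr_ge0 // ltW.
rewrite subSn // exprS; move: (Ex _) (rho ^+ _) ((N - s)%:R : R) => a b m.
by rewrite le_eqVlt; apply/orP; left; apply/eqP; ring.
Qed.

Lemma le_1Bexp (q : R) (L : nat) : q <= 1 -> (1 - q) ^+ L <= expR (- (q * L%:R)).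
Proof.
move=> q1; rewrite mulrC -mulrN mulrC expRM_natr.
by apply: lerXn2r; rewrite ?nnegrE ?expR_ge0 ?subr_ge0 // expR_ge1Dx.
Qed.

Lemma le_1Dexp (q : R) (L : nat) : 0 <= q -> (1 + q) ^+ L <= expR (q * L%:R).
Proof.
move=> q0; rewrite expRM_natr.
by apply: lerXn2r; rewrite ?nnegrE ?expR_ge0 ?addr_ge0 // expR_ge1Dx.
Qed.

(* [x ^ W], stopped when [good] fails, is a supermartingale up to a factor
   [1 - (1 - x) M / N] per round. *)
Lemma lower_tail (good : pred (seq E)) (W : seq E -> nat) (c : seq E -> pred E)
    (s0 s1 k : nat) (M x : R) :
  0 < x <= 1 -> (s0 <= s1)%N -> (s1 <= N)%N -> 0 <= M ->
  (forall h e, uniq (rcons h e) -> (s0 <= size h < s1)%N -> good (rcons h e) ->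
     good h /\ W (rcons h e) = (W h + c h e)%N) ->
  (forall h, uniq h -> (s0 <= size h < s1)%N -> good h ->
     M <= #|[set e | (e \notin h) && c h e]|%:R) ->
  (forall h, uniq h -> size h = s1 -> good h -> (W h <= k)%N) ->
  Pr (fun o => good (take s1 o)) <=
    x ^- k * expR (- ((1 - x) * M / N%:R * (s1 - s0)%:R)).
Proof.
move=> /andP[x0 x1] s01 s1N M0 goodS useful Wk.
have [eqs|neqs] := eqVneq s0 s1.
  apply: le_trans (Pr_le1 _) _; rewrite eqs subnn mulr0 oppr0 expR0 mulr1.
  by rewrite -exprVn exprn_ege1 // invr_ge1 ?unitf_gt0.
have lts : (s0 < s1)%N by rewrite ltn_neqAle neqs.
have N0 : (0 : R) < N%:R by rewrite ltr0n (leq_trans _ s1N) // (leq_ltn_trans _ lts).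
set q := (1 - x) * M / N%:R.
pose g h : R := (good h)%:R * x ^+ W h.
have xk0 : 0 < x ^+ k by rewrite exprn_gt0.
have g0 h : 0 <= g h by rewrite mulr_ge0 // exprn_ge0 // ltW.
have [MN|MN] := leP M N%:R; last first.
  have p0 : 0 <= x ^- k * expR (- (q * (s1 - s0)%:R)).
    by rewrite mulr_ge0 ?expR_ge0 // invr_ge0 ltW.
  apply: le_trans p0.
  rewrite -[leRHS](Ex_cst 0); apply: Ex_le => o uo.
  rewrite (_ : good _ = false) //; apply/negP.
  have eqs1 : s1 = s1.-1.+1 by rewrite prednK // (leq_ltn_trans _ lts).
  have s1N' : (s1.-1 < N)%N by rewrite -eqs1.
  have sz : size (take s1.-1 o) = s1.-1 by rewrite size_take size_tuple s1N'.
  rewrite {1}eqs1 (take_nth (tnth o (Ordinal s1N'))) ?size_tuple // => go.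
  have rg : (s0 <= size (take s1.-1 o) < s1)%N by rewrite sz {3}eqs1 ltnS leqnn andbT -ltnS -eqs1.
  have [|g1 _] := goodS _ _ _ rg go.
    by rewrite -take_nth ?size_tuple // take_uniq.
  have := useful _ (take_uniq _ uo) rg g1.
  by rewrite leNgt (le_lt_trans _ MN) // ler_nat max_card.
have q1 : q <= 1.
  rewrite /q ler_pdivrMr // mul1r (le_trans _ MN) // ler_piMl //; lra.
have step h : uniq h -> (s0 <= size h < s1)%N ->
    \sum_(e | e \notin h) g (rcons h e) <= (1 - q) * (N - size h)%:R * g h.
  move=> uh hs.
  have hN : (size h <= N)%N by case/andP: hs => _ /ltnW/leq_trans; apply.
  have cardh : (#|[predC h]| = N - size h)%N.
    by rewrite -(cardC (mem h)) (card_uniqP uh) addKn.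
  have [gh|gh] := boolP (good h); last first.
    rewrite big1 => [|e eh]; first by rewrite mulr_ge0 // mulr_ge0 // subr_ge0.
    rewrite /g (_ : good _ = false) ?mul0r //; apply/negP => /goodS[]//.
    - by rewrite rcons_uniq eh.
    - by rewrite (negbTE gh).
  have gE : g h = x ^+ W h by rewrite /g gh mul1r.
  have U := useful h uh hs gh.
  have le1 : \sum_(e | e \notin h) g (rcons h e) <=
      \sum_(e | e \notin h) (g h - (1 - x) * g h * (c h e)%:R).
    apply: ler_sum => e eh; rewrite {1}/g.
    have [gr|gr] := boolP (good (rcons h e)); last first.
      rewrite mul0r; case: (c h e); last by rewrite mulr0 subr0.
      rewrite mulr1 -{1}[g h]mul1r -mulrBl opprB addrC subrK mulr_ge0 // ltW //.
    have [|_ ->] := goodS h e _ hs gr; first by rewrite rcons_uniq eh.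
    rewrite mul1r exprD gE; case: (c h e); rewrite /= ?expr1 ?expr0.
      by rewrite mulr1 mulrBl mul1r opprB addrC subrK mulrC.
    by rewrite mulr1 mulr0 subr0.
  apply: le_trans le1 _.
  rewrite big_split /= sumr_const -mulr_natr (_ : #|_| = N - size h)%N; last first.
    by rewrite -cardh; apply: eq_card => e; rewrite !inE.
  rewrite sumrN -mulr_sumr (_ : \sum_(_ | _) _ = #|[set e | (e \notin h) && c h e]|%:R); last first.
    rewrite -sum1_card natr_sum big_mkcond /= [RHS]big_mkcond /=; apply: eq_bigr => e _.
    by rewrite inE; case: (e \notin h); case: (c h e).
  set u := #|_|%:R in U *; set m := (N - size h)%:R.
  have mN : m <= N%:R by rewrite ler_nat leq_subr.
  have x10 : 0 <= (1 - x) * g h by rewrite mulr_ge0 // subr_ge0.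
  suff : q * m * g h <= (1 - x) * g h * u by lra.
  rewrite mulrAC [_ * g h]mulrC mulrA.
  apply: (@le_trans _ _ ((1 - x) * g h * M)); last exact: ler_wpM2l.
  rewrite (_ : _ * m = (1 - x) * g h * (M * (m / N%:R))); last by rewrite /q; ring.
  rewrite ler_wpM2l // ler_piMr // ler_pdivrMr // mul1r //.
have := Ex_supermartingale s01 s1N _ step; rewrite subr_ge0 => /(_ q1) gle.
have le1 : Ex (fun o => g (take s0 o)) <= 1.
  rewrite -[leRHS](Ex_cst 1); apply: Ex_le => o _; rewrite /g.
  by case: (good _); rewrite ?mul0r ?mul1r // exprn_ile1 // ltW.
have le2 : Pr (fun o => good (take s1 o)) <= x ^- k * Ex (fun o => g (take s1 o)).
  rewrite -ExZ; apply: Ex_le => w uo; rewrite /g.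
  have [go|gn] := boolP (good (take s1 w)); last by rewrite mul0r mulr0.
  rewrite mul1r mulrC ler_pdivlMr // mul1r; apply: ler_wiXn2l => //; first exact: ltW.
  by apply: Wk => //; rewrite ?take_uniq // size_take size_tuple; case: ltngtP s1N.
apply: le_trans le2 _; apply: ler_wpM2l; first by rewrite invr_ge0 ltW.
apply: (le_trans gle); apply: le_trans (le_1Bexp _ q1).
by rewrite ler_piMr // exprn_ge0 // subr_ge0.
Qed.

Lemma upper_tail (S : {set E}) (k T : nat) : (T < N)%N ->
  Pr (fun o => (k <= count (mem S) (take T o))%N) <=
    2 ^- k * expR (#|S|%:R / (N - T)%:R * T%:R).
Proof.
move=> TN; set q : R := #|S|%:R / (N - T)%:R.
have q0 : 0 <= q by rewrite divr_ge0.
have m0 : (0 : R) < (N - T)%:R by rewrite ltr0n subn_gt0.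
pose g (h : seq E) : R := 2 ^+ count (mem S) h.
have step h : uniq h -> (0 <= size h < T)%N ->
    \sum_(e | e \notin h) g (rcons h e) <= (1 + q) * (N - size h)%:R * g h.
  move=> uh /= hT.
  have cardh : (#|[predC h]| = N - size h)%N.
    by rewrite -(cardC (mem h)) (card_uniqP uh) addKn.
  have g0 : 0 <= g h by rewrite exprn_ge0.
  apply: (@le_trans _ _ (\sum_(e | e \notin h) (g h + g h * (e \in S)%:R))).
    apply: ler_sum => e _; rewrite /g -cats1 count_cat /= addn0 exprD.
    case: (e \in S); rewrite /= ?expr1 ?expr0; last by rewrite mulr1 mulr0 addr0.
    by rewrite mulr1 mulr_natr mulr2n.
  rewrite big_split /= sumr_const -[g h *+ _]mulr_natr (_ : #|_| = N - size h)%N; last first.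
    by rewrite -cardh; apply: eq_card => e; rewrite !inE.
  rewrite -mulr_sumr; set u := \sum_(_ | _) _; set m := (N - size h)%:R.
  have uS : u <= #|S|%:R.
    rewrite -sum1_card natr_sum /u big_mkcond /= [leRHS]big_mkcond /=.
    by apply: ler_sum => e _; case: (e \notin h); case: (e \in S).
  suff um : u <= q * m.
    by rewrite -mulrDr mulrC ler_wpM2r // mulrDl mul1r lerD2l.
  apply: le_trans uS _; rewrite /q mulrAC ler_pdivlMr // ler_wpM2l // ler_nat.
  by rewrite leq_sub2l // ltnW.
have := Ex_supermartingale (leq0n T) (ltnW TN) _ step; rewrite addr_ge0 // => /(_ isT).
rewrite subn0 => gle.
have le2 : Pr (fun o => (k <= count (mem S) (take T o))%N) <=
    2 ^- k * Ex (fun o => g (take T o)).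
  rewrite -ExZ; apply: Ex_le => o uo; rewrite /g mulrC.
  have [kc|_] := boolP (k <= _)%N; last by rewrite divr_ge0 // exprn_ge0.
  by rewrite ler_pdivlMr ?exprn_gt0 // mul1r ler_eXn2l // ltr1n.
apply: le_trans le2 _; rewrite ler_wpM2l ?invr_ge0 ?exprn_ge0 //.
apply: le_trans gle _; apply: le_trans (le_1Dexp _ q0).
rewrite (_ : Ex _ = 1) ?mulr1 // -[RHS](Ex_cst 1); congr (_ / _).
by apply: eq_bigr => o _; rewrite take0 /g /= expr0.
Qed.
End RandomOrder.

(** * Greedy acceptance with degree caps *)

Section Greedy.
Variable n : nat.
Local Notation E := (edge n).
Implicit Types (A B : {set E}) (u v w : 'I_n) (e : E) (l : seq E).

Definition ends e : {set 'I_n} := val e.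

Lemma ends_inj : injective ends.
Proof. exact: val_inj. Qed.

Lemma card_ends e : #|ends e| = 2.
Proof. exact/eqP/(valP e). Qed.

Lemma edge_ends e : exists u v, u != v /\ ends e = [set u; v].
Proof.
have /cards2P[u [v [uv eq]]] : #|ends e| == 2 by rewrite card_ends.
by exists u, v.
Qed.

Lemma edge_of u v : u != v -> exists e : E, ends e = [set u; v].
Proof.
by move=> uv; have h : #|[set u; v]| == 2 by [rewrite cards2 uv]; exists (exist _ [set u; v] h).
Qed.

Lemma adjP A u v : reflect (exists2 e, e \in A & ends e = [set u; v]) (adj A u v).
Proof. by apply: (iffP exists_inP) => -[e eA eq]; exists e => //; apply/eqP. Qed.

Lemma adjC A : symmetric (adj A).
Proof. by move=> u v; rewrite /adj /= setUC. Qed.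

Lemma adj_neq A u v : adj A u v -> u != v.
Proof.
case/adjP => e _ eq; apply/eqP => uv.
by have := card_ends e; rewrite eq uv setUid cards1.
Qed.

Lemma adj_sub A B u v : A \subset B -> adj A u v -> adj B u v.
Proof.
by move=> AB /adjP[e eA eq]; apply/adjP; exists e => //; apply: (subsetP AB).
Qed.

Lemma adj0 u v : adj (set0 : {set E}) u v = false.
Proof. by apply/adjP => -[e]; rewrite inE. Qed.

Lemma adjU1 A e u v : adj (e |: A) u v = (ends e == [set u; v]) || adj A u v.
Proof.
apply/adjP/orP => [[e']|[/eqP eq|/adjP[e' eA eq]]].
- by rewrite !inE => /orP[/eqP ->|eA] eq; [left; apply/eqP|right; apply/adjP; exists e'].
- by exists e; rewrite ?inE ?eqxx.
- by exists e'; rewrite ?inE ?eA ?orbT.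
Qed.

Lemma eq_set2 (T : finType) (a b u v : T) :
  [set a; b] = [set u; v] -> (a = u /\ b = v) \/ (a = v /\ b = u).
Proof.
move=> eq.
have := set21 a b; have := set22 a b; have := set21 u v; have := set22 u v.
rewrite eq -{1 2}eq !inE.
by do 4![case/orP => /eqP ?]; subst; auto.
Qed.

Definition nbh A u (C : {set 'I_n}) := [set v in C | adj A u v].

Lemma nbh_sub A B u C : A \subset B -> nbh A u C \subset nbh B u C.
Proof.
move=> AB; apply/subsetP => v; rewrite !inE => /andP[-> /=]; exact: adj_sub.
Qed.

Lemma double_count A (X Y : {set 'I_n}) :
  \sum_(u in X) #|nbh A u Y| = \sum_(v in Y) #|nbh A v X|.
Proof.
have cnt (X' Y' : {set 'I_n}) : \sum_(u in X') #|nbh A u Y'| =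
    \sum_(u in X') \sum_(v in Y') (adj A u v : nat).
  apply: eq_bigr => u _; rewrite -sum1_card [RHS]big_mkcond /= big_mkcond /=.
  by apply: eq_bigr => v _; rewrite inE; case: (v \in Y'); case: (adj A u v).
rewrite !cnt exchange_big /=; apply: eq_bigr => v _; apply: eq_bigr => u _.
by rewrite adjC.
Qed.

Lemma card_edges_pairs A (P : rel 'I_n) :
  (forall e, e \in A -> exists u v, ends e = [set u; v] /\ P u v) ->
  #|A| <= #|[set p : 'I_n * 'I_n | P p.1 p.2 && adj A p.1 p.2]|.
Proof.
move=> PA; rewrite -(card_imset _ ends_inj).
apply: leq_trans (leq_imset_card (fun p : 'I_n * 'I_n => [set p.1; p.2]) _).
apply: subset_leq_card; apply/subsetP => s /imsetP[e eA ->].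
have [u [v [eq Puv]]] := PA e eA; apply/imsetP; exists (u, v) => //.
by rewrite inE Puv /=; apply/adjP; exists e.
Qed.

Lemma card_pairs A (X Y : {set 'I_n}) :
  #|[set p : 'I_n * 'I_n | [&& p.1 \in X, p.2 \in Y & adj A p.1 p.2]]| =
  \sum_(u in X) #|nbh A u Y|.
Proof.
rewrite -sum1_card (eq_bigr (fun u => \sum_(v in nbh A u Y) 1)); last first.
  by move=> u _; rewrite sum1_card.
rewrite pair_big_dep /=; apply: eq_bigl => -[u v]; rewrite !inE /=.
by case: (u \in X).
Qed.

Lemma card_edges_cover A (X Y : {set 'I_n}) (k : nat) :
  (forall e, e \in A -> exists u v, [/\ ends e = [set u; v], u \in X & v \in Y]) ->
  (forall u, u \in X -> #|nbh A u Y| <= k) -> #|A| <= k * #|X|.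
Proof.
move=> cov deg; apply: leq_trans (card_edges_pairs (P := fun u v => (u \in X) && (v \in Y)) _) _.
  by move=> e /cov[u [v [eq uX vY]]]; exists u, v; rewrite uX vY.
rewrite (_ : [set _ | _] = [set p : 'I_n * 'I_n | [&& p.1 \in X, p.2 \in Y & adj A p.1 p.2]]).
  by rewrite card_pairs mulnC -sum_nat_const leq_sum.
by apply/setP => p; rewrite !inE andbA.
Qed.

Lemma card_edges_degree A (X : {set 'I_n}) (k : nat) :
  (forall e, e \in A -> ends e \subset X) ->
  (forall u, u \in X -> #|nbh A u X| <= k) -> 2 * #|A| <= k * #|X|.
Proof.
move=> inX deg.
have bnd_lt (r : rel 'I_n) : (forall u v, u != v -> r u v || r v u) ->
    #|A| <= #|[set p : 'I_n * 'I_n | [&& r p.1 p.2, p.1 \in X, p.2 \in X & adj A p.1 p.2]]|.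
  move=> rT; apply: leq_trans
    (card_edges_pairs (P := fun u v => [&& r u v, u \in X & v \in X]) _) _; last first.
    by apply: subset_leq_card; apply/subsetP => p; rewrite !inE -!andbA.
  move=> e eA; have := inX e eA; have [u [v [uv ->]]] := edge_ends e.
  rewrite subUset !sub1set => /andP[uX vX].
  have /orP[ruv|rvu] := rT u v uv; first by exists u, v; rewrite ruv uX vX.
  by exists v, u; rewrite rvu uX vX setUC.
have dis : [set p : 'I_n * 'I_n | [&& p.1 < p.2, p.1 \in X, p.2 \in X & adj A p.1 p.2]] :&:
   [set p : 'I_n * 'I_n | [&& p.2 < p.1, p.1 \in X, p.2 \in X & adj A p.1 p.2]] = set0.
  by apply/setP => p; rewrite !inE; case: (ltngtP p.1 p.2) => _; rewrite /= ?andbF.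
have b1 := bnd_lt (fun u v => u < v); have b2 := bnd_lt (fun u v => v < u).
rewrite mul2n -addnn; apply: leq_trans (leq_add (b1 _) (b2 _)) _.
- by move=> u v; rewrite neq_ltn.
- by move=> u v; rewrite neq_ltn orbC.
rewrite -cardsUI dis cards0 addn0.
apply: (@leq_trans (\sum_(u in X) #|nbh A u X|)); last first.
  by rewrite mulnC -sum_nat_const leq_sum.
rewrite -card_pairs; apply: subset_leq_card; apply/subsetP => p.
by rewrite !inE; case/orP => /andP[_].
Qed.

Section Rule.
Variables (lab : 'I_n -> nat) (cp : 'I_n -> nat -> nat).

Definition nbp A u (j : nat) := #|nbh A u [set v | lab v == j]|.

(* [cp u j] caps the number of accepted neighbours of [u] with label [j]. *)
Definition ok A e :=
  [forall u in ends e, forall v in ends e, (u != v) ==> (nbp A u (lab v) < cp u (lab v))].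

Definition grow A e := if ok A e then e |: A else A.

Definition greedy l := foldl grow set0 l.

Lemma okP A e u v : ends e = [set u; v] -> u != v ->
  ok A e = (nbp A u (lab v) < cp u (lab v)) && (nbp A v (lab u) < cp v (lab u)).
Proof.
move=> eq uv; apply/idP/andP => [h|[h1 h2]].
  have /forall_inP/(_ u) := h; rewrite eq set21 => /(_ isT)/forall_inP/(_ v).
  rewrite set22 uv => /(_ isT) /= ->.
  have /forall_inP/(_ v) := h; rewrite eq set22 => /(_ isT)/forall_inP/(_ u).
  by rewrite set21 eq_sym uv => /(_ isT).
apply/forall_inP => x; rewrite eq !inE => xuv; apply/forall_inP => y; rewrite !inE => yuv.
apply/implyP; case/orP: xuv => /eqP ->; case/orP: yuv => /eqP -> //; by rewrite eqxx.
Qed.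

Lemma nbp_sub A B u j : A \subset B -> nbp A u j <= nbp B u j.
Proof. by move=> AB; apply/subset_leq_card/nbh_sub. Qed.

Lemma ok_sub A B e : A \subset B -> ok B e -> ok A e.
Proof.
move=> AB; have [u [v [uv eq]]] := edge_ends e; rewrite !(okP _ eq uv) => /andP[h1 h2].
by rewrite !(leq_ltn_trans (nbp_sub _ _ AB)).
Qed.

Lemma grow_sub A e : A \subset grow A e.
Proof. by rewrite /grow; case: ok => //; exact: subsetUr. Qed.

Lemma greedy_rcons l e : greedy (rcons l e) = grow (greedy l) e.
Proof. by rewrite /greedy -cats1 foldl_cat. Qed.

Lemma greedy_cat l l' : greedy l \subset greedy (l ++ l').
Proof.
elim/last_ind: l' => [|l' e IH]; first by rewrite cats0.
by rewrite -rcons_cat greedy_rcons (subset_trans IH) // grow_sub.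
Qed.

Lemma greedy_seen l : greedy l \subset [set e in l].
Proof.
elim/last_ind: l => [|l e IH]; first exact: sub0set.
rewrite greedy_rcons /grow; apply/subsetP => e'; rewrite inE mem_rcons inE.
case: ok => [|/(subsetP IH)]; last by rewrite inE => ->; rewrite orbT.
by rewrite !inE => /orP[->//|/(subsetP IH)]; rewrite inE => ->; rewrite orbT.
Qed.

Lemma greedy_cap l u j : nbp (greedy l) u j <= cp u j.
Proof.
elim/last_ind: l => [|l e IH].
  rewrite /nbp /nbh (_ : [set _ in _ | _] = set0) ?cards0 //.
  by apply/setP => v; rewrite !inE adj0 andbF.
rewrite greedy_rcons /grow; case: ifP => // oke.
have [a [b [ab eq]]] := edge_ends e.
have [x xe|none] := pickP [pred x | [&& lab x == j, u != x & ends e == [set u; x]]]; last first.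
  apply: leq_trans IH; apply: subset_leq_card; apply/subsetP => v; rewrite !inE adjU1.
  case/andP => lv; rewrite lv /= => /orP[euv|//].
  have := none v; rewrite /= lv euv !andbT => /negbFE /eqP uv.
  by have := card_ends e; rewrite (eqP euv) uv setUid cards1.
case/and3P: xe => /eqP lx ux /eqP eux.
move: oke; rewrite (okP _ eux ux) lx => /andP[lt _]; apply: leq_trans lt.
rewrite /nbp -addn1 -(cards1 x); apply: leq_trans (leq_card_setU _ _).
apply: subset_leq_card; apply/subsetP => v.
rewrite !inE adjU1 => /andP[-> /=]; rewrite eux => /orP[/eqP/eq_set2 h|->]; rewrite ?orbT //.
by apply/orP; right; case: h => -[h1 h2]; subst; rewrite ?eqxx.
Qed.

Lemma greedy_complete l e : e \in l -> ok (greedy l) e -> e \in greedy l.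
Proof.
move=> el; case/splitPr: el => l1 l2 oke.
have sub1 : greedy l1 \subset greedy (l1 ++ e :: l2) by exact: greedy_cat.
have sub2 : greedy (rcons l1 e) \subset greedy (l1 ++ e :: l2).
  by rewrite -cat_rcons greedy_cat.
apply: (subsetP sub2).
by rewrite greedy_rcons /grow (ok_sub sub1 oke) !inE eqxx.
Qed.

Lemma greedy_adj l u v : adj [set e in l] u v ->
  nbp (greedy l) u (lab v) < cp u (lab v) -> nbp (greedy l) v (lab u) < cp v (lab u) ->
  adj (greedy l) u v.
Proof.
move=> suv h1 h2; have uv := adj_neq suv; case/adjP: suv => e; rewrite inE => el eq.
by apply/adjP; exists e => //; apply: greedy_complete; rewrite // (okP _ eq uv) h1 h2.
Qed.

Lemma greedy_ends l e : e \in greedy l ->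
  forall u v, u \in ends e -> v \in ends e -> u != v -> 0 < cp u (lab v).
Proof.
move=> eA u v ue ve uv.
have eq : ends e = [set u; v].
  apply/esym/eqP; rewrite eqEcard subUset !sub1set ue ve /=.
  by rewrite card_ends cards2 uv.
apply: leq_trans (greedy_cap l u (lab v)); rewrite card_gt0; apply/set0Pn.
by exists v; rewrite !inE eqxx /=; apply/adjP; exists e.
Qed.

Lemma grow_card A e : e \notin A -> #|grow A e| = #|A| + ok A e.
Proof. by move=> eA; rewrite /grow; case: ok; rewrite ?addn0 // cardsU1 eA addnC. Qed.

End Rule.
End Greedy.

(** * Tail bounds *)

Section Tails.
Local Open Scope ring_scope.
Variables (R : realType) (n : nat).
Local Notation E := (edge n).
Local Notation N := #|edge n|.
Implicit Types (A : {set E}) (X Y : {set 'I_n}) (e : E) (h : seq E).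

Definition cross X Y : {set E} :=
  [set e | [exists u in X, [exists v in Y, ends e == [set u; v]]]].

Lemma crossP X Y e :
  reflect (exists u v, [/\ ends e = [set u; v], u \in X & v \in Y]) (e \in cross X Y).
Proof.
rewrite inE; apply: (iffP exists_inP) => [[u uX /exists_inP[v vY /eqP eq]]|[u [v [eq uX vY]]]].
  by exists u, v.
by exists u => //; apply/exists_inP; exists v => //; apply/eqP.
Qed.

Lemma card_cross X Y : [disjoint X & Y] -> #|cross X Y| = (#|X| * #|Y|)%N.
Proof.
move=> dXY; rewrite -(card_imset _ (@ends_inj n)) -cardsX.
have XY u : u \in X -> u \in Y -> False.
  by move=> uX uY; have := disjointFr dXY uX; rewrite uY.
rewrite -[RHS](@card_in_imset _ _ (fun p : 'I_n * 'I_n => [set p.1; p.2])).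
  apply: eq_card => s; apply/imsetP/imsetP => [[e /crossP[u [v [eq uX vY]]] ->]|].
    by exists (u, v); rewrite ?inE ?uX.
  case=> -[u v]; rewrite !inE /= => /andP[uX vY] ->.
  have uv : u != v by apply/eqP => uv; apply: (XY u) => //; rewrite uv.
  have [e eq] := edge_of uv; exists e => //; apply/crossP; by exists u, v.
move=> [u v] [u' v']; rewrite !inE /= => /andP[uX vY] /andP[uX' vY'] /eq_set2[[-> ->]//|[uv vu]].
by case: (XY u) => //; rewrite uv.
Qed.

Lemma card_crossI A X Y (k : nat) :
  (forall u, u \in X -> #|nbh A u Y| <= k)%N -> (#|cross X Y :&: A| <= k * #|X|)%N.
Proof.
move=> deg; apply: (@card_edges_cover _ _ _ Y) => [e|u uX].
  by rewrite inE => /andP[/crossP[u [v [eq uX vY]]] _]; exists u, v.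
apply: leq_trans (deg u uX); apply: subset_leq_card; apply: nbh_sub; exact: subsetIr.
Qed.

Lemma size_take_order (o : N.-tuple E) (s : nat) : (s <= N)%N -> size (take s o) = s.
Proof. by move=> sN; rewrite size_takel // size_tuple. Qed.

Lemma lower_tail_half (good : pred (seq E)) (W : seq E -> nat) (c : seq E -> pred E)
    (s0 s1 k : nat) (M : R) :
  (s0 <= s1)%N -> (s1 <= N)%N -> 0 <= M ->
  (forall h e, uniq (rcons h e) -> (s0 <= size h < s1)%N -> good (rcons h e) ->
     good h /\ W (rcons h e) = (W h + c h e)%N) ->
  (forall h, uniq h -> (s0 <= size h < s1)%N -> good h ->
     M <= #|[set e | (e \notin h) && c h e]|%:R) ->
  (forall h, uniq h -> size h = s1 -> good h -> (W h <= k)%N) ->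
  Pr R (fun o => good (take s1 o)) <= 2 ^+ k * expR (- (2^-1 * M / N%:R * (s1 - s0)%:R)).
Proof.
move=> s01 s1N M0 H1 H2 H3.
have x01 : 0 < (2^-1 : R) <= 1 by rewrite invr_gt0 ltr0n /= invf_le1 ?ler1n.
have := lower_tail x01 s01 s1N M0 H1 H2 H3.
have -> : (1 - 2^-1 : R) = 2^-1 by lra.
by rewrite exprVn invrK.
Qed.

Lemma star_tail (good0 : pred (seq E)) (V C : seq E -> {set 'I_n})
    (d q y z s0 s1 : nat) (x : R) :
  0 < x <= 1 -> (s0 <= s1)%N -> (s1 <= N)%N ->
  (forall h, uniq h -> size h = s0 -> good0 h ->
     [/\ [disjoint V h & C h], #|V h| = q, (y <= #|C h|)%N &
         forall v, v \in V h -> #|nbh [set e in h] v (C h)| <= z]%N) ->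
  Pr R (fun o => good0 (take s0 o) &&
        [forall v in V (take s0 o),
           #|nbh [set e in drop s0 (take s1 o)] v (C (take s0 o))| < d]%N) <=
    x ^- (q * d) *
    expR (- ((1 - x) * (q * (y - (z + d)))%:R / N%:R * (s1 - s0)%:R)).
Proof.
move=> x01 s01 s1N H.
pose good h := good0 (take s0 h) &&
  [forall v in V (take s0 h), (#|nbh [set e in drop s0 h] v (C (take s0 h))| < d)%N].
pose S h := cross (V (take s0 h)) (C (take s0 h)).
have Hdrop h : uniq h -> (s0 <= size h)%N -> good h ->
    (#|S h :&: [set e in drop s0 h]| <= q * d)%N.
  move=> uh hs /andP[g0 /forall_inP nb].
  have [||_ cV _ _] := H (take s0 h) _ _ g0; rewrite ?take_uniq ?size_takel //.
  rewrite -cV mulnC; apply: card_crossI => v /nb; exact: ltnW.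
apply: le_trans (_ : Pr R (fun o => good (take s1 o)) <= _).
  by apply: Pr_sub => o uo; rewrite /good !take_takel.
apply: (@lower_tail _ _ good (fun h => count (mem (S h)) (drop s0 h)) (fun h => mem (S h)))
  => //.
- move=> h e uhe /andP[hs _] /andP[]; rewrite /good /S -cats1 !takel_cat // drop_cat.
  rewrite ltn_neqAle hs andbT.
  have -> : (if s0 != size h then drop s0 h ++ [:: e] else drop (s0 - size h) [:: e]) =
      drop s0 h ++ [:: e].
    by case: eqP => //= ->; rewrite subnn drop0 drop_size.
  move=> -> /forall_inP nb; split; last by rewrite count_cat /= addn0.
  apply/forall_inP => v /nb; apply: leq_ltn_trans; apply: subset_leq_card.
  by apply: nbh_sub; apply/subsetP => e'; rewrite !inE mem_cat => ->.
- move=> h uh /andP[hs _] gh; rewrite ler_nat.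
  have [||dis cV cC deg] := H (take s0 h) _ _ (proj1 (andP gh)); rewrite ?take_uniq ?size_takel //.
  have cS : (q * y <= #|S h|)%N by rewrite /S card_cross // cV leq_mul2l cC orbT.
  have c1 : (#|S h :&: [set e in take s0 h]| <= q * z)%N.
    by rewrite -cV mulnC; exact: card_crossI.
  have c2 := Hdrop h uh hs gh.
  rewrite mulnBr mulnDr leq_subLR; apply: leq_trans cS _.
  rewrite -[#|S h|](cardsID [set e in h]); apply: leq_add; last first.
    by apply: eq_leq; apply: eq_card => e; rewrite !inE.
  apply: leq_trans (leq_add c1 c2); apply: leq_trans (leq_card_setU _ _).
  apply: subset_leq_card; apply/subsetP => e; rewrite !inE -{3}(cat_take_drop s0 h).
  by rewrite mem_cat => /andP[-> /=].
- move=> h uh hs gh; apply: leq_trans (Hdrop h uh _ gh); last by rewrite hs.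
  rewrite -size_filter -(card_uniqP (filter_uniq _ (drop_uniq _ uh))).
  by apply: subset_leq_card; apply/subsetP => e; rewrite mem_filter !inE.
Qed.

Lemma greedy_tail (good0 : pred (seq E)) (lab : 'I_n -> nat) (cp : seq E -> 'I_n -> nat -> nat)
    (i j y y' k s0 s1 : nat) :
  let A h := greedy lab (cp (take s0 h)) (drop s0 h) in
  let D h i j := [set u | (lab u == i) && (nbp lab (A h) u j < cp (take s0 h) u j)%N] in
  i != j -> (s0 <= s1)%N -> (s1 <= N)%N ->
  (forall h, uniq h -> (s0 <= size h)%N -> good0 (take s0 h) -> (y <= #|D h i j|)%N ->
     (y' <= #|D h j i|)%N) ->
  (forall h, uniq h -> (s0 <= size h)%N -> good0 (take s0 h) -> (#|A h| <= k)%N) ->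
  Pr R (fun o => good0 (take s0 o) && (y <= #|D (take s1 o) i j|)%N) <=
    2 ^+ k * expR (- (2^-1 * (y * y' - s1)%:R / N%:R * (s1 - s0)%:R)).
Proof.
move=> A D ij s01 s1N HD HA.
pose good h := good0 (take s0 h) && (y <= #|D h i j|)%N.
apply: le_trans (_ : Pr R (fun o => good (take s1 o)) <= _).
  by apply: Pr_sub => o uo; rewrite /good take_takel.
have dropS h e : (s0 <= size h)%N -> drop s0 (rcons h e) = rcons (drop s0 h) e.
  by move=> hs; rewrite drop_rcons.
have takeS h e : (s0 <= size h)%N -> take s0 (rcons h e) = take s0 h.
  by move=> hs; rewrite -cats1 takel_cat.
have AS h e : (s0 <= size h)%N -> A (rcons h e) = grow lab (cp (take s0 h)) (A h) e.
  by move=> hs; rewrite /A dropS // takeS // greedy_rcons.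
apply: (@lower_tail_half good (fun h => #|A h|) (fun h => ok lab (cp (take s0 h)) (A h))) => //.
- move=> h e uhe /andP[hs _] /andP[]; rewrite takeS // => g0 yD; split.
    rewrite /good g0; apply: leq_trans yD _; apply: subset_leq_card; apply/subsetP => u.
    rewrite !inE takeS // AS // => /andP[-> /=]; apply: leq_ltn_trans; apply: nbp_sub.
    exact: grow_sub.
  rewrite AS // grow_card //; apply/negP => /(subsetP (greedy_seen _ _ _)).
  by rewrite inE => /mem_drop eh; move: uhe; rewrite rcons_uniq eh.
- move=> h uh /andP[hs hs1] /andP[g0 yD]; rewrite ler_nat leq_subLR.
  have y'D := HD h uh hs g0 yD.
  have dis : [disjoint D h i j & D h j i].
    rewrite disjoints_subset; apply/subsetP => u; rewrite !inE => /andP[/eqP -> _].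
    by rewrite (negbTE ij).
  apply: (@leq_trans #|cross (D h i j) (D h j i)|).
    by rewrite card_cross // leq_mul.
  rewrite -(cardsID [set e in h]); apply: leq_add.
    apply: leq_trans (ltnW hs1); rewrite -(card_uniqP uh); apply: subset_leq_card.
    by apply/subsetP => e; rewrite !inE => /andP[].
  apply: subset_leq_card; apply/subsetP => e; rewrite inE 2!inE => /andP[-> /crossP].
  case=> u [v [eq]]; rewrite !inE => /andP[/eqP lu ltu] /andP[/eqP lv ltv].
  have uv : u != v by apply: contraNneq ij => uv; rewrite -lu -lv uv.
  by rewrite /= (okP _ _ _ eq uv) lu lv ltu ltv.
- by move=> h uh hs /andP[g0 _]; apply: HA => //; rewrite hs.
Qed.

Lemma core_tail (U : {set 'I_n}) (d y T : nat) :
  (0 < d)%N -> (0 < y)%N -> ((2 * d + 3) * y <= #|U|)%N -> (T <= N)%N ->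
  Pr R (fun o => ~~ [exists C : {set 'I_n}, [&& C \subset U, #|U| - y <= #|C| &
          kconn d (adj [set e in take T o | ends e \subset U]) C]%N]) <=
    4 ^+ #|U| * expR (- (2^-1 * (y * y)%:R / N%:R * T%:R)).
Proof.
move=> d0 y0 Uy TN.
pose P (p : {set 'I_n} * {set 'I_n}) h :=
  [&& [disjoint p.1 & p.2], y <= #|p.1|, y <= #|p.2| & ~~ has (mem (cross p.1 p.2)) h]%N.
pose I := setX (powerset U) (powerset U).
have cardI : #|I| = (4 ^ #|U|)%N.
  by rewrite cardsX card_powerset -expnD addnn -mul2n expnM.
apply: (@le_trans _ _ (Pr R (fun o => [exists p in I, P p (take T o)]))).
  apply: Pr_sub => o uo; apply: contraR => /existsPn nP; apply/existsP.
  have [|Y1 Y2 Y1U Y2U dY y1 y2|C [CU Cy kC]] := @expander_core _ d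
    (adj [set e in take T o | ends e \subset U]) _ U y d0 y0 Uy.
  - exact: adjC.
  - have := nP (Y1, Y2); rewrite /P /I !inE /= Y1U Y2U dY y1 y2 /= negbK.
    case/hasP => e eT /crossP[u [v [eq uY vY]]]; exists u, v; split=> //.
    apply/adjP; exists e => //; rewrite inE eT eq subUset !sub1set.
    by rewrite (subsetP Y1U) // (subsetP Y2U).
  - by exists C; rewrite CU Cy kC.
rewrite -natrX -cardI; apply: Pr_exists => -[Y1 Y2] _ /=.
have -> : expR (- (2^-1 * (y * y)%:R / N%:R * T%:R)) =
    2 ^+ 0 * expR (- (2^-1 * (y * y)%:R / N%:R * (T - 0)%:R)) :> R.
  by rewrite expr0 mul1r subn0.
apply: (@lower_tail_half (P (Y1, Y2)) (fun=> 0%N) (fun=> mem (cross Y1 Y2)) 0%N T 0%N) => //.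
- move=> h e _ _; rewrite /P /= -cats1 has_cat negb_or /= orbF.
  by case/and5P => -> -> -> -> /negbTE ->.
- move=> h _ _ /and4P[dY y1 y2 /hasPn nh]; rewrite ler_nat.
  apply: leq_trans (leq_mul y1 y2) _; rewrite /= -card_cross //.
  apply: subset_leq_card; apply/subsetP => e eC; rewrite inE eC andbT.
  by apply/negP => /nh; rewrite /= eC.
Qed.

Lemma degree_tail (z T : nat) : (T < N)%N ->
  Pr R (fun o : seq E => [exists v : 'I_n, z <= #|nbh [set e in take T o] v [set: 'I_n]|]%N) <=
    n%:R * (2 ^- z * expR (n%:R / (N - T)%:R * T%:R)).
Proof.
move=> TN.
pose Q (v : 'I_n) (h : seq E) := (z <= #|nbh [set e in take T h] v [set: 'I_n]|)%N.
apply: (@le_trans _ _ (Pr R (fun h => [exists v in [set: 'I_n], Q v h]))).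
  by apply: Pr_sub => o uo; case/existsP => v hv; apply/exists_inP; exists v.
set c : R := 2 ^- z * _.
have := @Pr_exists R n _ (mem [set: 'I_n]) Q c; rewrite cardsT card_ord; apply => v _.
rewrite /Q /c.
pose S := cross [set v] (~: [set v]).
have cS : (#|S| <= n)%N.
  have dv : [disjoint [set v] & ~: [set v]].
    by rewrite disjoints_subset setCK.
  by rewrite /S (card_cross dv) cards1 mul1n (leq_trans (max_card _)) // card_ord.
apply: (@le_trans _ _ (2 ^- z * expR (#|S|%:R / (N - T)%:R * T%:R))); last first.
  apply: ler_wpM2l; first by rewrite invr_ge0 exprn_ge0.
  rewrite ler_expR ler_wpM2r // ler_wpM2r ?invr_ge0 //.
  by rewrite ler_nat.
apply: le_trans (upper_tail R S z TN); apply: Pr_sub => o uo zn; apply: leq_trans zn _.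
rewrite -size_filter -(card_uniqP (filter_uniq _ (take_uniq _ uo))).
apply: (@leq_trans #|S :&: [set e in take T o]|); last first.
  by apply: subset_leq_card; apply/subsetP => e; rewrite mem_filter !inE.
rewrite -(card_imset _ (@ends_inj n)).
have vinj : {in nbh [set e in take T o] v setT &, injective (fun w => [set v; w])}.
  by move=> w w' _ _ /eq_set2[[]//|[<- ->]].
rewrite -(card_in_imset vinj); apply: subset_leq_card; apply/subsetP => s.
case/imsetP => w; rewrite !inE /= => vw ->; have nvw := adj_neq vw.
case/adjP: vw => e eT eq; apply/imsetP; exists e => //; rewrite inE eT andbT.
by apply/crossP; exists v, w; rewrite !inE eqxx eq_sym.
Qed.

End Tails.

(** * The chain structure *)

Section ChainStructure.
Variables (T : finType) (d m : nat) (e : rel T) (pc : T -> nat) (C W : {set T}).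
Hypotheses (e_sym : symmetric e) (d2 : 1 < d) (CW : C \subset W) (kC : kconn d e C).

Let nb (x : T) (Y : {set T}) := #|[set w in Y | e x w]|.

Hypothesis outW : forall x, x \notin W -> d <= nb x W.
Hypothesis inW : forall x, x \in W -> x \notin C ->
  d <= nb x C \/
  [/\ (1 < pc x < m) || (m.+1 < pc x < 2 * m),
      d./2 <= nb x [set w in W | pc w == (pc x).+1],
      d./2 <= nb x [set w in W | pc w == (pc x).-1] &
      odd d <= nb x [set w in W | pc w == if pc x <= m then pc x + m else pc x - m]].

(* The vertices of [X] of largest and smallest label have neighbours one layer
   above and one layer below all of [X]. *)
Lemma bnd_chain (X : {set T}) (lo hi : nat) :
  (forall x, x \in X :&: W -> lo <= pc x <= hi ->
     [/\ lo < pc x < hi, d./2 <= nb x [set w in W | pc w == (pc x).+1] &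
         d./2 <= nb x [set w in W | pc w == (pc x).-1]]) ->
  (exists2 x, x \in X :&: W & lo <= pc x <= hi) ->
  2 * d./2 <= #|bnd e X :&: [set w | lo <= pc w <= hi]|.
Proof.
move=> chX [x0 x0X x0h].
pose P x := (x \in X :&: W) && (lo <= pc x <= hi).
have Px0 : P x0 by rewrite /P x0X.
have [x /andP[xX xh] xmax] := arg_maxnP pc Px0.
have [z /andP[zX zh] zmin] := arg_minnP pc Px0.
have [xb xup _] := chX x xX xh; have [zb _ zdn] := chX z zX zh.
have pxz : pc z <= pc x by apply: xmax; rewrite /P zX.
rewrite mul2n -addnn; apply: leq_trans (leq_add xup zdn) _; rewrite /nb.
set S1 := [set _ in _ | e x _]; set S2 := [set _ in _ | e z _].
have dis : S1 :&: S2 = set0.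
  by apply/setP => w; rewrite !inE; apply/negP => /andP[/andP[/andP[_ /eqP ->] _] /andP[/andP[_ /eqP]]]; lia.
rewrite -cardsUI dis cards0 addn0; apply: subset_leq_card; apply/subsetP => w.
move: xX zX; rewrite !inE => /andP[xX _] /andP[zX _].
case/orP => /andP[/andP[wW /eqP pw] ew].
  apply/andP; split; last by rewrite pw; lia.
  apply/andP; split; last by apply/exists_inP; exists x.
  apply/negP => wX; have := xmax w; rewrite /P !inE wX wW pw => /(_ _); lia.
apply/andP; split; last by rewrite pw; lia.
apply/andP; split; last by apply/exists_inP; exists z.
apply/negP => wX; have := zmin w; rewrite /P !inE wX wW pw => /(_ _); lia.
Qed.

Lemma chain_structure : kconn d e setT.
Proof.
have dE : d = odd d + 2 * d./2 by rewrite mul2n odd_double_half.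
apply: (@kconn_grow _ d e e_sym C) => // X XC X0; rewrite setIT.
have XnC x : x \in X -> x \notin C by move/(subsetP XC); rewrite !inE andbT.
have star x Y : x \in X -> d <= nb x Y -> [disjoint X & Y] -> d <= #|bnd e X|.
  move=> xX dx dis; apply: leq_trans dx _; apply: subset_leq_card.
  apply/subsetP => w; rewrite !inE => /andP[wY exw].
  apply/andP; split; last by apply/exists_inP; exists x.
  by apply/negP => wX; have := disjointFr dis wX; rewrite wY.
have [/existsP[x /andP[xX dx]]|nC] := boolP [exists x in X, d <= nb x C].
  apply: star xX dx _; rewrite disjoints_subset; apply/subsetP => w /XnC.
  by rewrite inE.
have [XW|XW] := eqVneq (X :&: W) set0.
  case/set0Pn: X0 => x xX; apply: (star x W xX); last by rewrite -setI_eq0 XW.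
  by apply: outW; apply/negP => xW; have := in_set0 x; rewrite -XW inE xX xW.
have ch x : x \in X :&: W ->
    [/\ (1 < pc x < m) || (m.+1 < pc x < 2 * m),
      d./2 <= nb x [set w in W | pc w == (pc x).+1],
      d./2 <= nb x [set w in W | pc w == (pc x).-1] &
      odd d <= nb x [set w in W | pc w == if pc x <= m then pc x + m else pc x - m]].
  rewrite inE => /andP[xX xW]; case: (inW xW (XnC x xX)) => // dx.
  by case/negP: nC; apply/existsP; exists x; rewrite xX.
pose low := [set w | 1 <= pc w <= m]; pose high := [set w | m.+1 <= pc w <= 2 * m].
have disj : (bnd e X :&: low) :&: (bnd e X :&: high) = set0.
  by apply/setP => w; rewrite !inE; apply/negP; lia.
have two : #|bnd e X :&: low| + #|bnd e X :&: high| <= #|bnd e X|.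
  rewrite -cardsUI disj cards0 addn0; apply: subset_leq_card.
  by rewrite subUset !subsetIl.
have blow : (exists2 x, x \in X :&: W & 1 <= pc x <= m) -> 2 * d./2 <= #|bnd e X :&: low|.
  by apply: bnd_chain => x /ch[h1 h2 h3 _] h4; split=> //; lia.
have bhigh : (exists2 x, x \in X :&: W & m.+1 <= pc x <= 2 * m) ->
    2 * d./2 <= #|bnd e X :&: high|.
  by apply: bnd_chain => x /ch[h1 h2 h3 _] h4; split=> //; lia.
have odd1 : odd d <= 1 by case: odd.
have side x (S : {set T}) : x \in X :&: W ->
    (forall w, w \in W -> pc w = (if pc x <= m then pc x + m else pc x - m) -> w \in S) ->
    (forall w, w \in X :&: W -> w \notin S) -> odd d <= #|bnd e X :&: S|.
  move=> xXW inS nS; have [_ _ _ sd] := ch x xXW; apply: leq_trans sd _.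
  apply: subset_leq_card; apply/subsetP => w; rewrite !inE.
  case/andP => /andP[wW /eqP pw] exw; have wS := inS w wW pw; rewrite wS andbT.
  apply/andP; split; last by apply/exists_inP; exists x; move: xXW; rewrite ?inE // => /andP[].
  by apply/negP => wX; have := nS w; rewrite inE wX wW wS => /(_ isT).
have [/existsP[x /andP[xXW xl]]|nlow] := boolP [exists x in X :&: W, 1 <= pc x <= m].
  have bl := blow (ex_intro2 _ _ x xXW xl).
  have [/existsP[z /andP[zXW zh]]|nhigh] := boolP [exists x in X :&: W, m.+1 <= pc x <= 2 * m].
    by have bh := bhigh (ex_intro2 _ _ z zXW zh); lia.
  have := side x high xXW _ _; rewrite ?inE => sd.
  suff : odd d <= #|bnd e X :&: high| by lia.
  apply: sd => [w wW pw|w wXW].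
    by rewrite inE pw; case/andP: xl => x1 xm; rewrite xm; lia.
  rewrite inE; apply/negP => wh; case/negP: nhigh.
  by apply/existsP; exists w; rewrite wXW.
case/set0Pn: XW => x xXW; have [hx _ _ _] := ch x xXW.
have nl w : w \in X :&: W -> ~~ (1 <= pc w <= m).
  by move=> wXW; apply/negP => wl; case/negP: nlow; apply/existsP; exists w; rewrite wXW.
have nx := nl x xXW.
have xh : m.+1 <= pc x <= 2 * m by lia.
have bh := bhigh (ex_intro2 _ _ x xXW xh).
suff : odd d <= #|bnd e X :&: low| by lia.
have xm : (pc x <= m) = false by apply/negbTE; rewrite -ltnNge; case/andP: xh.
apply: (side x) => // [w wW|w /nl]; rewrite inE // xm => ->.
clear -xh; lia.
Qed.

End ChainStructure.

(** * The four phases *)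

Section Star.
Variables (n : nat) (B C : {set 'I_n}) (d : nat).
Hypothesis BC : [disjoint B & C].

Definition star_lab (v : 'I_n) : nat := v \in C.

Definition star_cp (u : 'I_n) (j : nat) : nat :=
  if (u \in B) && (j == 1) then d else if (u \in C) && (j == 0) then n else 0.

Definition star (l : seq (edge n)) := greedy star_lab star_cp l.

Let nbp1 A u : nbp star_lab A u 1 = #|nbh A u C|.
Proof.
rewrite /nbp; congr #|pred_of_set _|; apply/setP => v; rewrite !inE /star_lab.
by case: (v \in C).
Qed.

Lemma star_cap l v : v \in B -> #|nbh (star l) v C| <= d.
Proof.
by move=> vB; rewrite -nbp1; apply: leq_trans (greedy_cap _ _ _ _ _) _; rewrite /star_cp vB.
Qed.

Lemma card_nbh_lt A (u : 'I_n) (Y : {set 'I_n}) : #|nbh A u Y| < n.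
Proof.
rewrite -[X in _ < X](card_ord n) -cardsT; apply: proper_card; rewrite properE subsetT /=.
apply/subsetPn; exists u; rewrite ?inE //; apply/negP => /andP[_ /adj_neq].
by rewrite eqxx.
Qed.

Lemma star_full l v : v \in B -> d <= #|nbh [set e in l] v C| -> d <= #|nbh (star l) v C|.
Proof.
move=> vB dl; rewrite leqNgt; apply/negP => lt; move: dl; rewrite leqNgt => /negP; apply.
apply: leq_ltn_trans (lt); apply: subset_leq_card; apply/subsetP => w.
rewrite !inE => /andP[wC vw]; rewrite wC /=; have vC := disjointFr BC vB.
have wB := disjointFl BC wC.
apply: greedy_adj => //.
  by rewrite /star_lab wC nbp1 /star_cp vB.
by rewrite /star_lab vC /star_cp wB wC /= card_nbh_lt.
Qed.

Lemma star_edges l e : e \in star l ->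
  exists u v, [/\ ends e = [set u; v], u \in B & v \in C].
Proof.
move=> el; have [u [v [uv eq]]] := edge_ends e.
have := @greedy_ends _ star_lab star_cp l e el u v; rewrite eq set21 set22 uv.
have := @greedy_ends _ star_lab star_cp l e el v u; rewrite eq set21 set22 eq_sym uv.
move=> /(_ isT isT isT) + /(_ isT isT isT); rewrite /star_cp /star_lab.
have BnC x : x \in B -> x \in C -> False by move=> xB; rewrite (disjointFr BC xB).
case uB: (u \in B); case uC: (u \in C); case vB: (v \in B); case vC: (v \in C) => //=;
  rewrite ?ltnn // => _ _; try by [case: (BnC u uB uC)|case: (BnC v vB vC)].
  by exists u, v.
by exists v, u; rewrite setUC.

Qed.

Lemma card_star l : #|star l| <= d * #|B|.
Proof.
apply: (@card_edges_cover _ _ _ C) => [e /star_edges[u [v h]]|u uB]; last exact: star_cap.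
by exists u, v.
Qed.

End Star.

Section Phases.
Variables (n d m r s1 s2 s3 : nat).
Hypotheses (d2 : 1 < d) (m2 : 1 < m).
Local Notation E := (edge n).
Implicit Types (h l : seq E) (C : {set 'I_n}).

(* Layer [0] hosts the core, layers [1 .. m] and [m.+1 .. 2 * m] form two chains,
   and at most [layers] leftover vertices get a label [>= layers]. *)
Definition layers := (2 * m).+1.
Definition width := n %/ layers.
Definition layer (v : 'I_n) : nat := v %/ width.
Definition base : {set 'I_n} := [set v | layer v == 0].
Definition boundary (p : nat) := p \in [:: 1; m; m.+1; 2 * m].

(* Consecutive layers of a chain are to be joined by a nearly [d./2]-regular
   bipartite graph; if [d] is odd, layer [p] of the first chain is also nearly
   matched with layer [p + m] of the second one. *)
Definition cap (p q : nat) : nat :=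
  if [&& 0 < p <= 2 * m & 0 < q <= 2 * m] then
    if (p <= m) == (q <= m) then if (p.+1 == q) || (q.+1 == p) then d./2 else 0
    else if (p + m == q) || (q + m == p) then nat_of_bool (odd d) else 0
  else 0.

(* Boundary vertices want [d] neighbours in the core [C]; the vertices of [C]
   accept any number of them, [n] being an unreachable bound. *)
Definition chain_cp C (u : 'I_n) (j : nat) : nat :=
  if j == 0 then if boundary (layer u) then d else 0
  else if layer u == 0 then if (u \in C) && boundary j then n else 0
  else cap (layer u) j.

(* [s1 <= s2 <= s3] are the rounds that end the first three phases. *)
Definition base_edges h : {set E} := [set e in take s1 h | ends e \subset base].

Definition core_ok h C :=
  [&& C \subset base, #|base| <= 2 * #|C| & kconn d (adj (base_edges h)) C].

Definition core h : {set 'I_n} := odflt set0 [pick C | core_ok h C].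

Definition chain h : {set E} := greedy layer (chain_cp (core h)) (drop s1 (take s2 h)).

Definition chain_adj h : rel 'I_n :=
  [rel u v | [&& adj (chain h) u v, 0 < layer u & 0 < layer v]].

Definition unmet h (i j : nat) :=
  [set u | (layer u == i) && (nbp layer (chain h) u j < chain_cp (core h) u j)].

Definition bad h : {set 'I_n} := [set u | 0 < layer u < layers &
  [exists j : 'I_layers, nbp layer (chain h) u j < chain_cp (core h) u j]].

Definition ball h (k : nat) : {set 'I_n} :=
  iter k (fun B => B :|: [set v | [exists u in B, chain_adj h u v]]) (bad h).

Definition repair_seen h : seq E := drop s2 (take s3 h).

Definition repair h : {set E} := star (ball h r) (core h) d (repair_seen h).

Definition fail h (v : 'I_n) :=
  (v \in ball h r) && (#|nbh [set e in repair_seen h] v (core h)| < d).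

(* The vertices that defects spread to along chain edges, starting from a vertex
   with an unmet demand and staying among unrepaired vertices. *)
Definition lost h : {set 'I_n} := [set v | [exists f in bad h, fail h f &&
  connect [rel x y | [&& chain_adj h x y, fail h x & fail h y]] f v]].

Definition main h : {set 'I_n} :=
  ~: (lost h :|: (base :\: core h) :|: [set v | layers <= layer v]).

Definition final h : {set E} := star (~: main h) (main h) d (drop s3 h).

Definition built h := base_edges h :|: chain h :|: repair h :|: final h.

Lemma core_okP h : core h != set0 -> core_ok h (core h).
Proof. by rewrite /core; case: pickP => [C|] //=; rewrite eqxx. Qed.

Lemma capC p q : cap p q = cap q p.
Proof. by rewrite /cap andbC eq_sym ![(_ == q) || _]orbC. Qed.

Lemma core_base h : core h \subset base.
Proof.
have [->|/core_okP/and3P[]//] := eqVneq (core h) set0; exact: sub0set.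
Qed.

Lemma chain_ends h u v : adj (chain h) u v -> 0 < chain_cp (core h) u (layer v).
Proof.
move=> uv; have ne := adj_neq uv; case/adjP: uv => e eA eq.
by apply: (greedy_ends eA) ne; rewrite eq !inE eqxx ?orbT.
Qed.

Lemma chain_adj_cap h u v : chain_adj h u v -> 0 < cap (layer u) (layer v).
Proof.
by case/and3P => + u0 v0 => /chain_ends; rewrite /chain_cp !gtn_eqF.
Qed.

Lemma chain_adj_degree h u : #|[set v | chain_adj h u v]| <= d.
Proof.
have dE : d = odd d + 2 * d./2 by rewrite mul2n odd_double_half.
pose p := layer u; pose S q := nbh (chain h) u [set v | (0 < layer v) && (layer v == q)].
have S_le q : 0 < p -> 0 < q -> #|S q| <= cap p q.
  move=> p0 q0; apply: (@leq_trans (nbp layer (chain h) u q)).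
    by apply: subset_leq_card; apply/subsetP => v; rewrite !inE => /andP[/andP[_ ->]].
  apply: leq_trans (greedy_cap _ _ _ _ _) _.
  by rewrite /chain_cp gtn_eqF // gtn_eqF.
have [p0|p0] := posnP p.
  rewrite (_ : [set v | _] = set0) ?cards0 //.
  by apply/setP => v; rewrite !inE; apply/negP => /and3P[_]; rewrite -/p p0.
have cov : [set v | chain_adj h u v] \subset
    S p.-1 :|: S p.+1 :|: S (if p <= m then p + m else p - m).
  apply/subsetP => v; rewrite inE => uv; have := chain_adj_cap uv.
  case/and3P: uv => auv _ v0; rewrite !inE auv v0 !andbT /= -/p /cap.
  move: (layer v) v0 => q q0; clearbody p; clear -p0 q0 m2.
  by case: ifP => // hpq; case: ifP => h1; case: ifP => // h2 _; case: ifP => h3; lia.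
apply: leq_trans (subset_leq_card cov) _.
have a1 : #|S p.-1| <= d./2.
  have [p1|p1] := posnP p.-1.
    rewrite (_ : S _ = set0) ?cards0 //; apply/setP => v; rewrite !inE p1.
    by case: (layer v).
  apply: leq_trans (S_le _ p0 p1) _; rewrite /cap; case: ifP => // _.
  case: ifP => _; case: ifP => // hh; clear -hh p0 m2; lia.
have a2 : #|S p.+1| <= d./2.
  apply: leq_trans (S_le _ p0 _) _ => //; rewrite /cap; case: ifP => // _.
  case: ifP => _; case: ifP => // hh; clear -hh p0 m2; lia.
have a3 : #|S (if p <= m then p + m else p - m)| <= odd d.
  have q0 : 0 < (if p <= m then p + m else p - m) by clearbody p; clear -p0 m2; case: ifP => ?; lia.
  apply: leq_trans (S_le _ p0 q0) _; clearbody p; clear -p0 m2 q0; move: q0; rewrite /cap.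
  case: (leqP p m) => h3 q0; case: ifP => // h4; case: ifP => h1; case: ifP => // h2;
    by move: h1 h2 h4; clear -p0 m2 q0 h3; lia.
apply: leq_trans (leq_card_setU _ _) _.
apply: leq_trans (leq_add (leq_trans (leq_card_setU _ _) (leq_add a1 a2)) a3) _.
by rewrite {4}dE mul2n -addnn addnC.
Qed.

Lemma card_ball h k : #|ball h k| <= d.+1 ^ k * #|bad h|.
Proof.
elim: k => [|k IH]; first by rewrite expn0 mul1n.
rewrite /ball iterS -/(ball h k) expnS -mulnA.
apply: leq_trans (leq_card_setU _ _) _.
suff : #|[set v | [exists u in ball h k, chain_adj h u v]]| <= d * #|ball h k|.
  move=> step; apply: leq_trans (leq_mul (leqnn d.+1) IH).
  by rewrite mulSn leq_add2l.
rewrite mulnC -sum_nat_const.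
apply: leq_trans (_ : \sum_(u in ball h k) #|[set v | chain_adj h u v]| <= _); last first.
  by apply: leq_sum => u _; exact: chain_adj_degree.
rewrite (_ : [set v | _] = \bigcup_(u in ball h k) [set v | chain_adj h u v]).
  by elim/big_rec2: _ => [|u a b _ IHb]; rewrite ?cards0 //;
    apply: leq_trans (leq_card_setU _ _) _; rewrite leq_add2l.
apply/setP => v; rewrite inE; apply/exists_inP/bigcupP => -[u uB uv]; exists u => //.
  by rewrite inE.
by move: uv; rewrite inE.
Qed.

Lemma sub_ball h j k : j <= k -> ball h j \subset ball h k.
Proof.
move=> jk; rewrite -(subnKC jk); elim: (k - j) => [|i IH]; first by rewrite addn0.
rewrite addnS; apply: subset_trans IH _.
by rewrite {2}/ball iterS -/(ball h _) subsetUl.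
Qed.

Lemma ball_path h f p k : f \in bad h -> path (chain_adj h) f p -> size p <= k ->
  last f p \in ball h k.
Proof.
move=> fb pth sp; apply: (subsetP (sub_ball h sp)).
elim/last_ind: p pth {sp} => [|p v IH] //; rewrite rcons_path => /andP[pth pv].
rewrite last_rcons size_rcons /ball iterS -/(ball h _) !inE; apply/orP; right.
by apply/exists_inP; exists (last f p) => //; exact: IH.
Qed.

Lemma ball_layer h k v : v \in ball h k -> 0 < layer v.
Proof.
elim: k v => [|k IH] v; first by rewrite inE => /andP[/andP[]].
rewrite /ball iterS -/(ball h k) !inE => /orP[/IH//|/exists_inP[u _]].
by case/and3P.
Qed.

Lemma ball_core h k : [disjoint ball h k & core h].
Proof.
rewrite disjoints_subset; apply/subsetP => v /ball_layer lv; rewrite inE.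
by apply/negP => /(subsetP (core_base h)); rewrite inE gtn_eqF.
Qed.

(* Failing paths have fewer than [r] edges, so lost vertices are at distance less
   than [r] from [bad h] and their neighbours are still in the ball. *)
Lemma lost_next h u v :
  (forall f p, path (chain_adj h) f p -> uniq (f :: p) -> size p = r ->
     ~~ all (fail h) (f :: p)) ->
  u \in lost h -> chain_adj h u v -> v \in ball h r /\ (fail h v -> v \in lost h).
Proof.
move=> nopath; rewrite inE => /exists_inP[f fb /andP[ff /connectP[p0 pth0 lu]]] uv.
case/shortenP: pth0 lu => p pth up _ lu; set rl := [rel x y | _] in pth.
have pchain : path (chain_adj h) f p by apply: sub_path pth => x y /and3P[].
have allp : all (fail h) (f :: p).
  rewrite /= ff /=; elim: (p) (f) ff pth {up lu pchain} => //= x q IH g fg /andP[/and3P[_ _ fx] pq].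
  by rewrite fx (IH x).
have szp : size p < r.
  rewrite ltnNge; apply/negP => rp.
  have := nopath f (take r p); rewrite size_takel // => /(_ _ _ erefl)/negP; apply.
  - by move: pchain; rewrite -{1}(cat_take_drop r p) cat_path => /andP[].
  - by have := take_uniq r.+1 up.
  - by apply/allP => x xt; apply: (allP allp); have := @mem_take r.+1 _ (f :: p) x xt.
have vB : v \in ball h r.
  have := @ball_path h f (rcons p v) r fb; rewrite last_rcons size_rcons rcons_path pchain -lu.
  exact.
split=> // fv; rewrite inE; apply/exists_inP; exists f => //; rewrite ff /=.
apply: (@connect_trans _ rl u); first by apply/connectP; exists p.
apply: connect1.
by rewrite /rl /= uv fv lu andbT; apply: (allP allp); exact: mem_last.
Qed.

Lemma layer_main h v : v \in main h -> v \notin core h -> 0 < layer v < layers.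
Proof.
rewrite !inE !negb_or negb_and negbK -ltnNge => /andP[/andP[_ hb] ->] vC.
by rewrite andbT lt0n; move: hb; rewrite (negbTE vC).
Qed.

Lemma core_main h : core h \subset main h.
Proof.
apply/subsetP => v vC; have := subsetP (core_base h) v vC; rewrite inE => /eqP l0.
rewrite !inE vC l0 leqn0 /layers /= !orbF; apply/negP => /exists_inP[f _ /andP[ff]].
case/connectP => p; case/lastP: p => [_ vf|p w]; last first.
  rewrite rcons_path last_rcons => /andP[_ /and3P[_ _ /andP[/ball_layer lw _]]] vw.
  by move: lw; rewrite -vw l0.
by move: ff => /andP[/ball_layer]; rewrite -[f]/(last f [::]) -vf l0.
Qed.

Lemma boundary_inner p : ~~ boundary p -> 0 < p -> p < layers ->
  [/\ (1 < p < m) || (m.+1 < p < 2 * m), 0 < p.+1 < layers, 0 < p.-1 < layers &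
     0 < (if p <= m then p + m else p - m) < layers].
Proof.
rewrite /boundary !inE /layers !negb_or => /and4P[b1 b2 b3 b4] p0 pQ; clear -b1 b2 b3 b4 p0 pQ.
by split; try lia; case: ifP => ?; lia.
Qed.

Lemma cap_inner p : (1 < p < m) || (m.+1 < p < 2 * m) ->
  [/\ cap p p.+1 = d./2, cap p p.-1 = d./2 &
     cap p (if p <= m then p + m else p - m) = odd d].
Proof.
rewrite /cap => pm; clear -pm; split.
- have -> : (0 < p <= 2 * m) && (0 < p.+1 <= 2 * m) by lia.
  have -> : ((p <= m) == (p.+1 <= m)) = true by lia.
  by rewrite eqxx.
- have -> : (0 < p <= 2 * m) && (0 < p.-1 <= 2 * m) by lia.
  have -> : ((p <= m) == (p.-1 <= m)) = true by lia.
  have -> : (p.-1.+1 == p) = true by lia.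
  by rewrite orbT.
case: (leqP p m) => xm.
- have -> : (0 < p <= 2 * m) && (0 < p + m <= 2 * m) by lia.
  have -> : (p + m <= m) = false by lia.
  by rewrite eqxx.
- have -> : (0 < p <= 2 * m) && (0 < p - m <= 2 * m) by lia.
  have -> : (p - m <= m) = true by lia.
  have -> : (p - m + m == p) = true by lia.
  by rewrite orbT.
Qed.

Lemma built_kconn h :
  core h != set0 ->
  (forall f p, path (chain_adj h) f p -> uniq (f :: p) -> size p = r ->
     ~~ all (fail h) (f :: p)) ->
  (forall v, v \notin main h -> d <= #|nbh [set e in drop s3 h] v (main h)|) ->
  kconn d (adj (built h)) setT.
Proof.
move=> core0 nopath fin; have /and3P[_ _ kC] := core_okP core0.
have sub1 : base_edges h \subset built h.
  by rewrite /built -!setUA subsetUl.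
have sub2 : chain h \subset built h.
  by rewrite /built; apply/subsetP => e eA; rewrite !inE eA ?orbT.
have sub3 : repair h \subset built h.
  by rewrite /built; apply/subsetP => e eA; rewrite !inE eA ?orbT.
have sub4 : final h \subset built h by rewrite /built subsetUr.
have dis4 : [disjoint ~: main h & main h].
  by rewrite disjoints_subset setCK.
have sub_nb (A : {set E}) v (Y : {set 'I_n}) : A \subset built h -> #|nbh A v Y| <= #|[set w in
    Y | adj (built h) v w]|.
  by move=> AG; apply: subset_leq_card; exact: nbh_sub.
apply: (@chain_structure _ d m (adj (built h)) layer (core h) (main h)).
- exact: adjC.
- exact: d2.
- exact: core_main.
- apply/forallP => S; apply/implyP => Sd; have := implyP (forallP kC S) Sd.
  move=> /forall_inP cS; apply/forall_inP => x xS; apply/forall_inP => y yS.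
  have := forall_inP (cS x xS) y yS; apply: connect_sub => u v /and3P[uS vS uv].
  by apply: connect1; rewrite /= uS vS (adj_sub sub1 uv).
- move=> x xW; apply: leq_trans (sub_nb _ _ _ sub4); apply: (star_full dis4).
    by rewrite in_setC.
  exact: fin.
move=> x xW xC; have /andP[x0 xQ] := layer_main xW xC.
have xlost : x \notin lost h by move: xW; rewrite !inE !negb_or => /andP[/andP[]].
have [xB|xB] := boolP ((x \in ball h r) && ~~ fail h x).
  left; apply: leq_trans (sub_nb _ _ _ sub3); case/andP: xB => xB xf.
  apply: star_full => //; first exact: ball_core.
  by move: xf; rewrite /fail xB /= -leqNgt.
have failx : x \in ball h r -> fail h x by move=> xr; move: xB; rewrite xr /= negbK.
have xbad : x \notin bad h.
  apply/negP => xb; case/negP: xlost; rewrite inE; apply/exists_inP; exists x => //.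
  by rewrite connect0 andbT failx // (subsetP (sub_ball h (leq0n r))).
have met j : j < layers -> chain_cp (core h) x j <= nbp layer (chain h) x j.
  move=> jQ; rewrite leqNgt; apply/negP => lt; case/negP: xbad.
  by rewrite inE x0 xQ /=; apply/existsP; exists (Ordinal jQ).
have [bx|bx] := boolP (boundary (layer x)).
  left; have := met 0 (ltn0Sn _); rewrite /chain_cp bx => dx; apply: leq_trans dx _.
  apply: subset_leq_card; apply/subsetP => w; rewrite !inE => /andP[/eqP lw xw].
  rewrite (adj_sub sub2 xw) andbT; have := xw; rewrite adjC => /chain_ends.
  by rewrite /chain_cp gtn_eqF // lw /=; case: (w \in core h).
right; have met' j : 0 < j < layers -> cap (layer x) j <=
    #|[set w in [set w in main h | layer w == j] | adj (built h) x w]|.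
  case/andP => j0 jQ; have := met j jQ; rewrite /chain_cp !gtn_eqF // => /leq_trans; apply.
  apply: subset_leq_card; apply/subsetP => w; rewrite 2!inE => /andP[/eqP lw xw].
  rewrite in_set in_set lw eqxx (adj_sub sub2 xw) !andbT.
  have xwc : chain_adj h w x by rewrite /chain_adj /= adjC xw lw j0 x0.
  rewrite !inE lw leqNgt jQ orbF (gtn_eqF j0) andbF orbF; apply/negP => wl.
  have wlost : w \in lost h by rewrite inE.
  have [xb lx] := lost_next nopath wlost xwc.
  by case/negP: xlost; apply: lx; exact: failx.
have [inner h1 h2 h3] := boundary_inner bx x0 xQ.
have capE j c : 0 < j < layers -> cap (layer x) j = c -> c <=
    #|[set w in [set w in main h | layer w == j] | adj (built h) x w]|.
  by move=> jQ <-; exact: met'.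
by split=> //; apply: capE => //; have [] := cap_inner inner.
Qed.

End Phases.

Section Sizes.
Variables (n d m r s1 s2 s3 : nat).
Hypotheses (d2 : 1 < d) (m2 : 1 < m).
Local Notation E := (edge n).
Local Notation w := (width n m).
Hypothesis w0 : 0 < w.
Implicit Types (h : seq E).

Lemma card_layer (j : nat) : #|[set v : 'I_n | layer m v == j]| <= w.
Proof.
have inj : {in [set v : 'I_n | layer m v == j] &, injective (fun v : 'I_n => Ordinal (ltn_pmod v w0))}.
  move=> u v; rewrite !inE /layer => /eqP lu /eqP lv /(congr1 val) /= uv.
  by apply: val_inj; rewrite /= (divn_eq u w) (divn_eq v w) uv lu lv.
by rewrite -(card_in_imset inj) (leq_trans (max_card _)) // card_ord.
Qed.

Lemma layers_width : layers m * w <= n.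
Proof. by rewrite mulnC leq_trunc_div. Qed.

Lemma card_layerE (j : nat) : j < layers m -> #|[set v : 'I_n | layer m v == j]| = w.
Proof.
move=> jm; apply/eqP; rewrite eqn_leq card_layer /=.
have lt (i : 'I_w) : j * w + i < n.
  apply: leq_trans layers_width; apply: leq_trans (leq_mul jm (leqnn w)).
  by rewrite mulSn addnC ltn_add2r.
pose f i := Ordinal (lt i).
have inj : injective f by move=> i k /(congr1 val) /= /addnI/val_inj.
rewrite -[X in X <= _]card_ord -(card_imset predT inj); apply: subset_leq_card.
apply/subsetP => v /imsetP[i _ ->].
by rewrite inE /layer /= divnMDl // divn_small // addn0.
Qed.

Lemma card_base : #|base n m| = w.
Proof. exact: card_layerE. Qed.

Lemma card_leftover : #|[set v : 'I_n | layers m <= layer m v]| <= layers m.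
Proof.
have inj : {in [set v : 'I_n | layers m <= layer m v] &,
    injective (fun v : 'I_n => inord (v - layers m * w) : 'I_(layers m))}.
  have lt (v : 'I_n) : layers m <= layer m v -> layers m * w <= v /\ v - layers m * w < layers m.
    rewrite /layer leq_divRL // => lv; split=> //; rewrite ltn_subLR //.
    apply: leq_trans (ltn_ord v) _.
    by rewrite {1}(divn_eq n (layers m)) mulnC leq_add2l ltnW // ltn_pmod.
  move=> u v; rewrite !inE => /lt[u1 u2] /lt[v1 v2] /(congr1 val) /=; rewrite !inordK // => uv.
  by apply: val_inj => /=; rewrite -(subnK u1) uv subnK.
by rewrite -(card_in_imset inj) (leq_trans (max_card _)) // card_ord.
Qed.

Lemma core_card h : core d m s1 h != set0 -> w <= 2 * #|core d m s1 h|.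
Proof. by move=> /core_okP/and3P[_ + _]; rewrite card_base. Qed.

Lemma core_exists h (y : nat) : 2 * y <= w ->
  [exists C : {set 'I_n}, [&& C \subset base n m, #|base n m| - y <= #|C| &
     kconn d (adj (base_edges m s1 h)) C]] -> core d m s1 h != set0.
Proof.
move=> yw /existsP[C /and3P[Cb Cy kC]]; rewrite card_base in Cy.
have okC : core_ok d m s1 h C by rewrite /core_ok Cb kC andbT card_base; lia.
rewrite /core; case: pickP => [C' /and3P[_ +_]|/(_ C)]; last by rewrite okC.
by rewrite card_base /= -card_gt0; case: #|C'|; rewrite // muln0 leqNgt w0.
Qed.

Lemma card_chain h : 2 * #|chain d m s1 s2 h| <= d * n + 2 * (d * (4 * w)).
Proof.
set A := chain d m s1 s2 h; set C := core d m s1 h.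
have degA u : #|nbh A u (~: base n m)| <= d \/ u \in base n m.
  have [ub|ub] := boolP (u \in base n m); [by right|left].
  apply: leq_trans (chain_adj_degree d s1 s2 m2 h u); apply: subset_leq_card.
  apply/subsetP => v; rewrite !inE => /andP[vb uv].
  by rewrite inE in ub; rewrite /chain_adj /= uv !lt0n vb ub.
pose Ain := [set e in A | ends e \subset ~: base n m].
have cin : 2 * #|Ain| <= d * n.
  apply: (@leq_trans (d * #|~: base n m|)); last first.
    by rewrite leq_mul2l (leq_trans (max_card _)) ?card_ord ?orbT.
  apply: card_edges_degree => [e|u uX]; first by rewrite inE => /andP[].
  have [du|ub] := degA u; last by move: uX; rewrite inE ub.
  apply: leq_trans du; apply: subset_leq_card; apply: nbh_sub.
  by apply/subsetP => e; rewrite inE => /andP[].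
pose X := [set u : 'I_n | boundary m (layer m u)].
have cX : #|X| <= 4 * w.
  rewrite !mulSn mul0n addn0 !addnA.
  have sub : X \subset [set u | layer m u == 1] :|: [set u | layer m u == m] :|:
     [set u | layer m u == m.+1] :|: [set u | layer m u == 2 * m].
    by apply/subsetP => u; rewrite inE /boundary !inE -!orbA.
  apply: leq_trans (subset_leq_card sub) _.
  do 3![apply: leq_trans (leq_card_setU _ _) _; apply: leq_add; last exact: card_layer].
  exact: card_layer.
have cout : #|A :\: Ain| <= d * (4 * w).
  apply: leq_trans (leq_mul (leqnn d) cX); apply: (@card_edges_cover _ _ _ (base n m)).
    move=> e; rewrite !inE => /andP[/negP ne eA].
    have [u [v [uv eq]]] := edge_ends e.
    have cp (x y : 'I_n) : ends e = [set x; y] -> layer m x = 0 -> y \in X.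
      move=> eq' x0; have : adj A y x by rewrite adjC; apply/adjP; exists e.
      move/chain_ends; rewrite inE /chain_cp x0 /=; by case: boundary.
    have [ub|ub] := eqVneq (layer m u) 0.
      by exists v, u; split; [rewrite eq setUC|exact: cp eq ub|rewrite inE ub].
    have [vb|vb] := eqVneq (layer m v) 0.
      by exists u, v; split; [|apply: cp vb; rewrite eq setUC|rewrite inE vb].
    by case: ne; rewrite eA eq subUset !sub1set !inE ub vb.
  move=> u; rewrite inE => bu; apply: leq_trans (_ : nbp (layer m) A u 0 <= _).
    by apply: subset_leq_card; apply: nbh_sub; exact: subsetDl.
  by apply: leq_trans (greedy_cap _ _ _ _ _) _; rewrite /chain_cp bu.
have AE : #|A| = #|Ain| + #|A :\: Ain|.
  rewrite -[LHS](cardsID Ain); congr (_ + _); apply: eq_card => e; rewrite !inE.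
  by case: (e \in A).
by rewrite AE mulnDr leq_add // leq_mul2l cout orbT.
Qed.

Lemma card_bad h (y : nat) :
  (forall i j : 'I_(layers m), i != j -> 0 < i -> #|unmet d m s1 s2 h i j| <= y) ->
  #|bad d m s1 s2 h| <= layers m * layers m * y.
Proof.
move=> uy; pose I := [set p : 'I_(layers m) * 'I_(layers m) | (p.1 != p.2) && (0 < p.1)].
have cI : #|I| <= layers m * layers m.
  by rewrite (leq_trans (max_card _)) // card_prod !card_ord.
apply: leq_trans (_ : \sum_(p in I) #|unmet d m s1 s2 h p.1 p.2| <= _); last first.
  apply: leq_trans (leq_mul cI (leqnn y)); rewrite -sum_nat_const.
  by apply: leq_sum => -[i j]; rewrite inE => /andP[ij i0]; exact: uy.
apply: leq_trans (_ : #|\bigcup_(p in I) unmet d m s1 s2 h p.1 p.2| <= _).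
  apply: subset_leq_card; apply/subsetP => u; rewrite inE => /andP[/andP[u0 um]].
  case/existsP => j lt; apply/bigcupP; exists (Ordinal um, j); last by rewrite !inE eqxx.
  rewrite inE u0 andbT /= ; apply/negP => /eqP uj; move: lt.
  rewrite -uj /chain_cp /= gtn_eqF // /cap.
  case: ifP => //= _; rewrite eqxx; case: ifP => // h1 _.
  by move: h1; clear; lia.
by elim/big_rec2: _ => [|p a b _ IHb]; rewrite ?cards0 //;
  apply: leq_trans (leq_card_setU _ _) _; rewrite leq_add2l.
Qed.

Lemma card_lost h : #|lost d m r s1 s2 s3 h| <= #|ball d m s1 s2 h r|.
Proof.
apply: subset_leq_card; apply/subsetP => v; rewrite inE => /exists_inP[f _ /andP[ff]].
case/connectP => p; case/lastP: p => [_ -> /=|p x]; first by case/andP: ff.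
by rewrite rcons_path last_rcons => /andP[_ /and3P[_ _ /andP[xB _]]] ->.
Qed.

Lemma card_mainC h :
  #|~: main d m r s1 s2 s3 h| <= #|ball d m s1 s2 h r| + w + layers m.
Proof.
rewrite /main setCK; apply: leq_trans (leq_card_setU _ _) _.
apply: leq_add; last exact: card_leftover.
apply: leq_trans (leq_card_setU _ _) _; apply: leq_add; first exact: card_lost.
by rewrite -card_base subset_leq_card // subsetDl.
Qed.

Lemma card_built h (k y : nat) :
  #|base_edges m s1 h| <= k ->
  (forall i j : 'I_(layers m), i != j -> 0 < i -> #|unmet d m s1 s2 h i j| <= y) ->
  let b := d.+1 ^ r * (layers m * layers m * y) in
  #|~: main d m r s1 s2 s3 h| <= b + w + layers m /\
  2 * #|built d m r s1 s2 s3 h| <= d * n + 2 * (k + d * (5 * w + 2 * b + layers m)).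
Proof.
move=> kb uy b.
have cb : #|ball d m s1 s2 h r| <= b.
  apply: leq_trans (card_ball _ _ _ m2 _ _) _; rewrite leq_mul2l.
  by rewrite card_bad ?orbT.
have cm : #|~: main d m r s1 s2 s3 h| <= b + w + layers m.
  by apply: leq_trans (card_mainC h) _; rewrite !leq_add2r.
split=> //.
have c2 := card_chain h.
have c3 : #|repair d m r s1 s2 s3 h| <= d * b.
  apply: leq_trans (card_star d (ball_core d m s1 s2 h r) _) _.
  by rewrite leq_mul2l cb orbT.
have c4 : #|final d m r s1 s2 s3 h| <= d * (b + w + layers m).
  apply: leq_trans (card_star d _ _) _; last by rewrite leq_mul2l cm orbT.
  by rewrite disjoints_subset setCK.
have cu : #|built d m r s1 s2 s3 h| <= #|base_edges m s1 h| + #|chain d m s1 s2 h| +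
    #|repair d m r s1 s2 s3 h| + #|final d m r s1 s2 s3 h|.
  rewrite /built; do 3![apply: leq_trans (leq_card_setU _ _) _; rewrite leq_add2r //].
clearbody b; move: cu c2 c3 c4 kb; clear.
move: #|base_edges _ _ _| #|chain _ _ _ _ _| #|repair _ _ _ _ _ _ _| #|final _ _ _ _ _ _ _|.
move: #|built _ _ _ _ _ _ _| (width n m) (layers m) => x0 w l x1 x2 x3 x4; lia.
Qed.

Lemma unmet_cap h (i j : nat) : 0 < i -> 0 < j -> i < layers m -> j < layers m ->
  #|unmet d m s1 s2 h i j| <= d * #|unmet d m s1 s2 h j i|.
Proof.
move=> i0 j0 im jm.
have tot i' j' : 0 < i' -> 0 < j' -> i' < layers m ->
    \sum_(u in [set u : 'I_n | layer m u == i']) (cap d m i' j' -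
       #|nbh (chain d m s1 s2 h) u [set v | layer m v == j']|) +
    \sum_(u in [set u : 'I_n | layer m u == i'])
       #|nbh (chain d m s1 s2 h) u [set v | layer m v == j']| = w * cap d m i' j'.
  move=> i0' j0' im'; rewrite -big_split /= -(card_layerE im') -sum_nat_const.
  apply: eq_bigr => u; rewrite inE => /eqP lu; apply: subnK.
  apply: leq_trans (greedy_cap _ _ _ _ _) _.
  by rewrite /chain_cp lu !gtn_eqF.
have capd i' j' : cap d m i' j' <= d.
  rewrite /cap; case: ifP => // _; case: ifP => _; case: ifP => //= _; last by case: (odd d); lia.
  by rewrite -divn2 leq_div.
have := tot j i j0 i0 jm; rewrite (capC d m j i) -(tot i j i0 j0 im).
rewrite [X in _ + X = _]double_count => /esym/eqP; rewrite eqn_add2r => /eqP Deq.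
have unmetE i' j' u : 0 < i' -> 0 < j' -> u \in unmet d m s1 s2 h i' j' =
    (layer m u == i') && (0 < cap d m i' j' - #|nbh (chain d m s1 s2 h) u [set v | layer m v == j']|).
  move=> i0' j0'; rewrite inE; case: eqP => //= lu.
  by rewrite subn_gt0 /chain_cp lu !gtn_eqF.
apply: (@leq_trans (\sum_(u in [set u : 'I_n | layer m u == i]) (cap d m i j -
       #|nbh (chain d m s1 s2 h) u [set v | layer m v == j]|))).
  rewrite -sum1_card big_mkcond [leqRHS]big_mkcond /=; apply: leq_sum => u _.
  by rewrite unmetE // !inE; case: eqP => //= _; case: (_ - _).
rewrite Deq mulnC -sum_nat_const big_mkcond [leqRHS]big_mkcond /=; apply: leq_sum => u _.
rewrite unmetE // !inE -capC; case: eqP => //= _; case: posnP => [->//|_].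
exact: leq_trans (leq_subr _ _) (capd _ _).
Qed.

End Sizes.

Section Events.
Local Open Scope ring_scope.
Variables (R : realType) (n d m r s1 s2 s3 : nat).
Hypotheses (d2 : (1 < d)%N) (m2 : (1 < m)%N).
Local Notation E := (edge n).
Local Notation N := #|edge n|.
Local Notation w := (width n m).
Local Notation L := (layers m).
Hypothesis w0 : (0 < w)%N.
Hypotheses (s12 : (s1 <= s2)%N) (s23 : (s2 <= s3)%N) (s3N : (s3 < N)%N).
Implicit Types (h : seq E).

Lemma core_take s h : (s1 <= s)%N -> core d m s1 (take s h) = core d m s1 h.
Proof. by move=> s1s; rewrite /core /core_ok /base_edges take_takel. Qed.

Lemma chain_take s h : (s2 <= s)%N -> chain d m s1 s2 (take s h) = chain d m s1 s2 h.
Proof.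
move=> s2s; have s1s := leq_trans s12 s2s.
by rewrite /chain (core_take _ s1s) (take_takel _ s2s).
Qed.

Lemma unmet_take s h i j : (s2 <= s)%N -> unmet d m s1 s2 (take s h) i j = unmet d m s1 s2 h i j.
Proof.
move=> s2s; have s1s := leq_trans s12 s2s.
by rewrite /unmet (chain_take _ s2s) (core_take _ s1s).
Qed.

Lemma ball_take s h k : (s2 <= s)%N -> ball d m s1 s2 (take s h) k = ball d m s1 s2 h k.
Proof.
move=> s2s; have s1s := leq_trans s12 s2s.
by rewrite /ball /bad /chain_adj (chain_take _ s2s) (core_take _ s1s).
Qed.

Lemma main_take s h : (s3 <= s)%N -> main d m r s1 s2 s3 (take s h) = main d m r s1 s2 s3 h.
Proof.
move=> s3s; have s2s := leq_trans s23 s3s; have s1s := leq_trans s12 s2s.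
rewrite /main /lost /fail /repair_seen (ball_take _ _ s2s) /bad /chain_adj.
by rewrite (chain_take _ s2s) (core_take _ s1s) (take_takel _ s3s).
Qed.

Lemma Pr_core (y : nat) : (0 < y)%N -> ((2 * d + 3) * y <= w)%N ->
  Pr R (fun o : seq E => core d m s1 o == set0) <=
    4 ^+ w * expR (- (2^-1 * (y * y)%:R / N%:R * s1%:R)).
Proof.
move=> y0 yw; have s1N : (s1 <= N)%N by rewrite (leq_trans s12) // (leq_trans s23) // ltnW.
rewrite -(card_base w0).
apply: le_trans (@core_tail R n (base n m) d y s1 _ y0 _ s1N); rewrite ?card_base ?(ltnW d2) //.
apply: Pr_sub => o uo; apply: contraTN => ex.
have y2w : (2 * y <= w)%N; last first.
  by rewrite -(card_base w0) in ex; exact: (core_exists d2 m2 w0 y2w ex).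
by apply: leq_trans yw; rewrite leq_mul2r; apply/orP; right; lia.
Qed.

Lemma Pr_base_edges (k : nat) :
  Pr R (fun o : seq E => k <= #|base_edges m s1 o|)%N <=
    2 ^- k * expR ((w * w)%:R / (N - s1)%:R * s1%:R).
Proof.
have s1N : (s1 < N)%N by rewrite (leq_ltn_trans s12) // (leq_ltn_trans s23).
pose S := [set e : E | ends e \subset base n m].
have cS : (#|S| <= w * w)%N.
  apply: leq_trans (card_edges_pairs (P := fun u v => (u \in base n m) && (v \in base n m)) _) _.
    move=> e; rewrite inE; have [u [v [_ ->]]] := edge_ends e.
    by rewrite subUset !sub1set => uv; exists u, v.
  rewrite -{1 2}(card_base w0) -cardsX; apply: subset_leq_card.
  by apply/subsetP => p; rewrite !inE => /andP[].
apply: (@le_trans _ _ (2 ^- k * expR (#|S|%:R / (N - s1)%:R * s1%:R))); last first.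
  apply: ler_wpM2l; first by rewrite invr_ge0 exprn_ge0.
  by rewrite ler_expR ler_wpM2r // ler_wpM2r ?invr_ge0 // ler_nat.
apply: le_trans (upper_tail R S k s1N); apply: Pr_sub => o uo kn; apply: leq_trans kn _.
rewrite -size_filter -(card_uniqP (filter_uniq _ (take_uniq _ uo))).
by apply: subset_leq_card; apply/subsetP => e; rewrite mem_filter !inE andbC.
Qed.

Lemma Pr_unmet (y : nat) : (0 < y)%N -> (2 * y <= w)%N ->
  Pr R (fun o : seq E => (core d m s1 o != set0) &&
      [exists p in [set p : 'I_L * 'I_L | (p.1 != p.2) && (0 < p.1)%N],
         d * y <= #|unmet d m s1 s2 o p.1 p.2|]%N) <=
    (L * L)%:R * (2 ^+ (2 * d * n) *
       expR (- (2^-1 * (d * y * y - s2)%:R / N%:R * (s2 - s1)%:R))).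
Proof.
move=> y0 yw; set c : R := 2 ^+ _ * _.
have c0 : 0 <= c by rewrite mulr_ge0 ?exprn_ge0 ?expR_ge0.
pose P (p : 'I_L * 'I_L) (o : seq E) :=
  (core d m s1 o != set0) && (d * y <= #|unmet d m s1 s2 o p.1 p.2|)%N.
pose I := [set p : 'I_L * 'I_L | (p.1 != p.2) && (0 < p.1)%N].
have cI : (#|I| <= L * L)%N by rewrite (leq_trans (max_card _)) // card_prod !card_ord.
apply: (@le_trans _ _ (#|I|%:R * c)); last by rewrite ler_wpM2r // ler_nat.
apply: le_trans (_ : Pr R (fun o => [exists p in I, P p o]) <= _).
  apply: Pr_sub => o uo /andP[c1 /exists_inP[p pI py]]; apply/exists_inP; exists p => //.
  by rewrite /P c1.
apply: Pr_exists => -[i j]; rewrite inE /= => /andP[ij i0].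
have ij' : (i : nat) != j by rewrite (inj_eq val_inj).
have s2N : (s2 <= N)%N by rewrite (leq_trans s23) // ltnW.
pose cp h := chain_cp d m (core d m s1 h).
have chE h : greedy (layer m) (cp (take s1 h)) (drop s1 h) = chain d m s1 (size h) h.
  by rewrite /chain take_size /cp core_take.
have unE h i' j' : [set u | (layer m u == i') &&
     (nbp (layer m) (greedy (layer m) (cp (take s1 h)) (drop s1 h)) u j' <
      cp (take s1 h) u j')%N] = unmet d m s1 (size h) h i' j'.
  by rewrite chE /unmet /cp core_take.
apply: le_trans (@greedy_tail R n (fun h => core d m s1 h != set0) (layer m) cp i j (d * y) y
  (2 * d * n) s1 s2 ij' s12 s2N _ _); first last.
- move=> h uh _ _; rewrite chE -(leq_pmul2l (ltn0Sn 1)).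
  apply: leq_trans (card_chain _ _ _ m2 w0 _) _.
  have := layers_width n m; rewrite /layers; move: (width n m) => w'.
  by clear -m2 d2; nia.
- move=> h uh _ c0' ; rewrite !unE => yu.
  have d0 : (0 < d)%N by rewrite ltnW.
  have [j0|j0] := posnP j; last first.
    rewrite -(leq_pmul2l d0); apply: leq_trans yu _.
    exact: (unmet_cap s1 (size h) d2 m2 w0 h i0 j0 (ltn_ord i) (ltn_ord j)).
  have /set0Pn[u] : unmet d m s1 (size h) h i j != set0.
    by rewrite -card_gt0 (leq_trans _ yu) // muln_gt0 d0.
  rewrite inE /chain_cp j0 /= => /andP[/eqP ->]; case: ifP => // bi _.
  rewrite (core_take _ (leqnn s1)) in c0'.
  apply: (@leq_trans #|core d m s1 h|).
    have := core_card w0 c0'; by clear -yw; lia.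
  apply: subset_leq_card; apply/subsetP => v vC.
  have := subsetP (core_base d m s1 h) v vC; rewrite inE => /eqP lv.
  by rewrite inE lv eqxx /= /chain_cp gtn_eqF // lv /= vC bi card_nbh_lt.
apply: Pr_sub => o uo /andP[c1 uy].
rewrite unE (core_take _ (leqnn s1)) c1 (size_take_order _ s2N) (unmet_take _ _ _ (leqnn s2)).
exact: uy.
Qed.

End Events.

Section Union.
Local Open Scope ring_scope.
Variables (R : realType) (n d m r s1 s2 s3 : nat).
Hypotheses (d2 : (1 < d)%N) (m2 : (1 < m)%N).
Local Notation E := (edge n).
Local Notation N := #|edge n|.
Local Notation w := (width n m).
Local Notation L := (layers m).
Hypothesis w0 : (0 < w)%N.
Hypotheses (s12 : (s1 <= s2)%N) (s23 : (s2 <= s3)%N) (s3N : (s3 < N)%N).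
Implicit Types (h : seq E).

Definition step h (u : 'I_n) (i : 'I_d) : 'I_n :=
  nth u (enum [set v | chain_adj d m s1 s2 h u v]) i.

Definition walk h (v : 'I_n) (t : seq 'I_d) : seq 'I_n := v :: scanl (step h) v t.

Lemma walkP h f p : path (chain_adj d m s1 s2 h) f p ->
  exists t : (size p).-tuple 'I_d, walk h f t = f :: p.
Proof.
elim: p f => [|x p IH] f /=; first by exists [tuple].
case/andP => fx /IH[t tE]; set S := enum [set v | chain_adj d m s1 s2 h f v].
have xS : x \in S by rewrite mem_enum inE.
have lt : (index x S < d)%N.
  apply: leq_trans (chain_adj_degree d s1 s2 m2 h f).
  by rewrite cardE index_mem.
exists [tuple of Ordinal lt :: t]; rewrite /walk /=.
have -> : step h f (Ordinal lt) = x by rewrite /step /= nth_index.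
by case: tE => ->.
Qed.

Lemma walk_take s h v t : (s2 <= s)%N -> walk (take s h) v t = walk h v t.
Proof. by move=> s2s; rewrite /walk /step /chain_adj (chain_take d m s12 h s2s). Qed.

Lemma size_walk h v t : size (walk h v t) = (size t).+1.
Proof. by rewrite /walk /= size_scanl. Qed.

Definition low_degree (z : nat) h := [forall v : 'I_n, #|nbh [set e in h] v [set: 'I_n]| < z]%N.

Lemma low_degree_nbh z h v (Y : {set 'I_n}) :
  low_degree z h -> (#|nbh [set e in h] v Y| <= z)%N.
Proof.
move/forallP/(_ v)/ltnW; apply: leq_trans; apply: subset_leq_card.
by apply/subsetP => u; rewrite !inE => /andP[_ ->].
Qed.

Lemma low_degree_take z s s' h : (s <= s')%N ->
  low_degree z (take s' h) -> low_degree z (take s h).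
Proof.
move=> ss /forallP ld; apply/forallP => v; apply: leq_ltn_trans (ld v).
apply: subset_leq_card; apply: nbh_sub; apply/subsetP => e; rewrite !inE.
by rewrite -(take_takel h ss) => /mem_take.
Qed.

Lemma Pr_fail_path (z : nat) :
  Pr R (fun o : seq E => [&& core d m s1 o != set0, low_degree z (take s3 o) &
      [exists p in [set: 'I_n * r.-tuple 'I_d],
         uniq (walk o p.1 p.2) && all (fail d m r s1 s2 s3 o) (walk o p.1 p.2)]]) <=
    (n * d ^ r)%:R * (2 ^+ (r.+1 * d) *
       expR (- (2^-1 * (r.+1 * (w./2 - (z + d)))%:R / N%:R * (s3 - s2)%:R))).
Proof.
set c : R := 2 ^+ _ * _.
pose P (p : 'I_n * r.-tuple 'I_d) (o : seq E) :=
  [&& core d m s1 o != set0, low_degree z (take s3 o), uniq (walk o p.1 p.2) &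
    all (fail d m r s1 s2 s3 o) (walk o p.1 p.2)].
have cI : #|[set: 'I_n * r.-tuple 'I_d]| = (n * d ^ r)%N.
  by rewrite cardsT card_prod card_tuple !card_ord.
rewrite -cI; apply: le_trans (_ : Pr R (fun o => [exists p in [set: 'I_n * r.-tuple 'I_d], P p o]) <= _).
  apply: Pr_sub => o uo /and3P[c1 c2 /exists_inP[p pI pP]]; apply/exists_inP; exists p => //.
  by rewrite /P c1 c2.
apply: Pr_exists => -[v t] _.
pose good0 h := [&& core d m s1 h != set0, low_degree z h, uniq (walk h v t) &
   all [in ball d m s1 s2 h r] (walk h v t)].
pose V h := [set u in walk h v t].
have x01 : 0 < (2^-1 : R) <= 1 by rewrite invr_gt0 ltr0n /= invf_le1 ?ler1n.
have h12 : (1 - 2^-1 : R) = 2^-1 by lra.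
have HV h : uniq h -> size h = s2 -> good0 h ->
    [/\ [disjoint V h & core d m s1 h], #|V h| = r.+1, (w./2 <= #|core d m s1 h|)%N &
        forall u, u \in V h -> (#|nbh [set e in h] u (core d m s1 h)| <= z)%N].
  move=> uh hs /and4P[c1 ld uw ab]; split.
  - rewrite disjoint_subset; apply/subsetP => u; rewrite inE => uV.
    have uB := allP ab u uV; rewrite inE; apply/negP => uC.
    by have := disjointFr (ball_core d m s1 s2 h r) uB; rewrite uC.
  - by rewrite cardsE (card_uniqP uw) size_walk size_tuple.
  - by have := core_card w0 c1; clear; lia.
  - by move=> u _; exact: low_degree_nbh.
have := @star_tail R n good0 V (core d m s1) d r.+1 w./2 z s2 s3 (2^-1) x01 s23 (ltnW s3N) HV.
rewrite exprVn invrK h12; apply: le_trans.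
have s2s2 := leqnn s2.
apply: Pr_sub => o uo /and4P[c1 ld uw af].
have {}uw : uniq (walk o v t) := uw.
have {}af : all (fail d m r s1 s2 s3 o) (walk o v t) := af.
apply/andP; split.
  rewrite /good0 (core_take _ _ _ s12) c1 (low_degree_take s23 ld) (walk_take _ _ _ s2s2) uw !andTb.
  apply/allP => u /(allP af) /andP[uB _].
  by rewrite /= (ball_take _ _ s12 _ _ s2s2).
apply/forall_inP => u; rewrite inE (walk_take _ _ _ s2s2) => /(allP af) /andP[_].
by rewrite (core_take _ _ _ s12).
Qed.

Lemma Pr_final (z M t : nat) (x : R) : 0 < x <= 1 -> (s3 <= t)%N -> (t <= N)%N ->
  Pr R (fun o : seq E => [&& low_degree z (take s3 o), (M <= #|main d m r s1 s2 s3 o|)%N &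
      [exists v in [set: 'I_n], (v \notin main d m r s1 s2 s3 o) &&
        (#|nbh [set e in drop s3 (take t o)] v (main d m r s1 s2 s3 o)| < d)%N]]) <=
    n%:R * (x ^- d * expR (- ((1 - x) * (M - (z + d))%:R / N%:R * (t - s3)%:R))).
Proof.
move=> x01 s3t tN; set c : R := x ^- _ * _.
pose P (v : 'I_n) (o : seq E) :=
  [&& low_degree z (take s3 o), (M <= #|main d m r s1 s2 s3 o|)%N, v \notin main d m r s1 s2 s3 o &
   (#|nbh [set e in drop s3 (take t o)] v (main d m r s1 s2 s3 o)| < d)%N].
have cI : #|[set: 'I_n]| = n by rewrite cardsT card_ord.
apply: le_trans (_ : Pr R (fun o => [exists v in [set: 'I_n], P v o]) <= _).
  apply: Pr_sub => o uo /and3P[c1 c2 /exists_inP[p pI pP]]; apply/exists_inP; exists p => //.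
  by rewrite /P c1 c2.
have PP v : v \in [set: 'I_n] -> Pr R (P v) <= c.
  move=> _; pose good0 h := [&& low_degree z h, (M <= #|main d m r s1 s2 s3 h|)%N &
    v \notin main d m r s1 s2 s3 h].
  have HV h : uniq h -> size h = s3 -> good0 h ->
    [/\ [disjoint [set v] & main d m r s1 s2 s3 h], #|[set v]| = 1%N,
        (M <= #|main d m r s1 s2 s3 h|)%N &
        forall u, u \in [set v] -> (#|nbh [set e in h] u (main d m r s1 s2 s3 h)| <= z)%N].
    move=> uh hs /and3P[ld Mm vm]; split=> //.
    - rewrite disjoint_subset; apply/subsetP => u; rewrite inE => /eqP ->.
      by rewrite inE.
    - by rewrite cards1.
    - by move=> u _; exact: low_degree_nbh.
  have := @star_tail R n good0 (fun=> [set v]) (main d m r s1 s2 s3) d 1 M z s3 t x x01 s3t tN HV.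
  rewrite !mul1n; apply: le_trans; have s33 := leqnn s3.
  apply: Pr_sub => o uo /and4P[ld Mm vm lt]; apply/andP; split.
    by rewrite /good0 (main_take _ _ _ s12 s23 _ s33) ld Mm vm.
  apply/forall_inP => u; rewrite inE => /eqP ->.
  by rewrite (main_take _ _ _ s12 s23 _ s33).
have := @Pr_exists R n _ (mem [set: 'I_n]) P c PP.
by rewrite cI.
Qed.

Lemma Pr_built (k y0 y z M t : nat) (x : R) :
  let b := (d.+1 ^ r * (L * L * (d * y)))%N in
  (0 < y0)%N -> ((2 * d + 3) * y0 <= w)%N -> (0 < y)%N -> (2 * y <= w)%N ->
  (M + (b + w + L) <= n)%N -> 0 < x <= 1 -> (s3 <= t)%N -> (t <= N)%N ->
  Pr R (fun o : seq E =>
      ~~ (kconn d (adj (built d m r s1 s2 s3 (take t o))) [set: 'I_n] &&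
          (2 * #|built d m r s1 s2 s3 (take t o)| <= d * n + 2 * (k + d * (5 * w + 2 * b + L)))%N)) <=
    4 ^+ w * expR (- (2^-1 * (y0 * y0)%:R / N%:R * s1%:R)) +
    (2 ^- k * expR ((w * w)%:R / (N - s1)%:R * s1%:R) +
    (n%:R * (2 ^- z * expR (n%:R / (N - s3)%:R * s3%:R)) +
    ((L * L)%:R * (2 ^+ (2 * d * n) *
       expR (- (2^-1 * (d * y * y - s2)%:R / N%:R * (s2 - s1)%:R))) +
    ((n * d ^ r)%:R * (2 ^+ (r.+1 * d) *
       expR (- (2^-1 * (r.+1 * (w./2 - (z + d)))%:R / N%:R * (s3 - s2)%:R))) +
    n%:R * (x ^- d * expR (- ((1 - x) * (M - (z + d))%:R / N%:R * (t - s3)%:R))))))).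
Proof.
move=> b y00 y0w y10 yw Mn x01 s3t tN.
have p1 := Pr_core R d2 m2 w0 s12 s23 s3N y00 y0w.
have p2 := Pr_base_edges R w0 s12 s23 s3N k.
have p3 := degree_tail R z s3N.
have p4 := Pr_unmet R d2 m2 w0 s12 s23 s3N y10 yw.
have p5 := Pr_fail_path z.
have p6 := Pr_final z M x01 s3t tN.
apply: le_trans (lerD p1 (lerD p2 (lerD p3 (lerD p4 (lerD p5 p6))))).
apply: le_trans (lerD (lexx _) (lerD (lexx _) (lerD (lexx _) (lerD (lexx _) (Pr_or _ _ _))))).
apply: le_trans (lerD (lexx _) (lerD (lexx _) (lerD (lexx _) (Pr_or _ _ _)))).
apply: le_trans (lerD (lexx _) (lerD (lexx _) (Pr_or _ _ _))).
apply: le_trans (lerD (lexx _) (Pr_or _ _ _)).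
apply: le_trans (Pr_or _ _ _).
apply: Pr_sub => o uo; apply: contraR; rewrite !negb_or.
case/andP => e1 /andP[e2 /andP[e3 /andP[e4 /andP[e5 e6]]]].
have ld : low_degree z (take s3 o).
  by apply/forallP => v; rewrite ltnNge; apply: contra e3 => h; apply/existsP; exists v.
rewrite -ltnNge in e2; have s2t := leq_trans s23 s3t; have s1t := leq_trans s12 s2t.
have base_take : base_edges m s1 (take t o) = base_edges m s1 o.
  by rewrite /base_edges take_takel.
have small (i j : 'I_L) : i != j -> (0 < i)%N ->
    (#|unmet d m s1 s2 (take t o) i j| <= d * y)%N.
  move=> ij i0; rewrite (unmet_take _ _ s12 _ _ _ s2t).
  move: e4; rewrite negb_and e1 /= => /exists_inPn/(_ (i, j)).
  by rewrite inE /= ij i0 -ltnNge => /(_ isT)/ltnW.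
have cb : (#|base_edges m s1 (take t o)| <= k)%N by rewrite base_take ltnW.
have [cm cG] := card_built r s3 m2 w0 cb small.
rewrite cG andbT.
have Mm : (M <= #|main d m r s1 s2 s3 o|)%N.
  move: cm; rewrite (main_take _ _ _ s12 s23 _ s3t) cardsCs setCK card_ord -/b.
  by move: #|_| => c; clear -Mn; lia.
apply: built_kconn.
- exact: d2.
- by rewrite (core_take _ _ _ s1t).
- move=> f p pth up sp; apply/negP => af.
  rewrite (_ : chain_adj d m s1 s2 (take t o) = chain_adj d m s1 s2 o) in pth; last first.
    by rewrite /chain_adj (chain_take d m s12 o s2t).
  have [tt ttE] := walkP pth; rewrite sp in tt ttE.
  have af' : all (fail d m r s1 s2 s3 o) (f :: p).
    apply/allP => u /(allP af); rewrite /fail (ball_take _ _ s12 _ _ s2t) /repair_seen.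
    by rewrite (core_take _ _ _ s1t) (take_takel _ s3t).
  move: e5; rewrite e1 ld => /exists_inPn/(_ (f, tt) (in_setT _)) e5.
  have {e5} : ~~ (uniq (walk o f tt) && all (fail d m r s1 s2 s3 o) (walk o f tt)) := e5.
  by rewrite ttE up af'.
move=> v; rewrite (main_take _ _ _ s12 s23 _ s3t) => vm; rewrite leqNgt; apply/negP => lt.
move: e6; rewrite ld Mm /= => /exists_inPn/(_ v); rewrite in_setT => /(_ isT).
by rewrite vm lt.
Qed.


End Union.

(** * From edge sets to strategies *)

Section Online.
Variable n : nat.
Local Notation E := (edge n).
Implicit Types (h o : seq E) (e : E).

(* Whether the edge of a round belongs to [B] is known at that round. *)
Definition online (B : seq E -> {set E}) :=
  (forall h, B h \subset [set e in h]) /\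
  (forall h e e', uniq (rcons h e) -> e' \in h -> (e' \in B (rcons h e)) = (e' \in B h)).

Definition rule (B : seq E -> {set E}) (b : nat) (es : seq E) : bool :=
  if es is e :: es' then (last e es' \in B es) && (#|B es| <= b) else false.

Variables (B : seq E -> {set E}) (b : nat).
Hypothesis onB : online B.

Lemma online_take o e s : uniq o -> e \in take s o ->
  (e \in B (take s o)) = (e \in B (take (index e o).+1 o)).
Proof.
move=> uo; elim: s => [|s IH]; first by rewrite take0.
have [so|so] := leqP (size o) s.
  by move: IH; rewrite (take_oversize so) (take_oversize (leqW so)).
rewrite (take_nth e) // => es.
have [eqe|neqe] := eqVneq e (nth e o s).
  have ie : index e o = s by rewrite {1}eqe index_uniq.
  by rewrite ie (take_nth e so).
move: es; rewrite mem_rcons inE (negbTE neqe) /= => es.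
rewrite (proj2 onB) //; last by rewrite -take_nth // take_uniq.
exact: IH.
Qed.

Lemma ruleE o e s : uniq o -> e \in take s o ->
  rule B b (take (index e o).+1 o) =
  (e \in B (take s o)) && (#|B (take (index e o).+1 o)| <= b).
Proof.
move=> uo es; rewrite (online_take uo es); have eo := mem_take es.
have io : index e o < size o by rewrite index_mem.
rewrite (take_nth e) // nth_index //.
by rewrite /rule; case eqr: (rcons _ e) => [|x l]; [case: (take _ o) eqr|
  rewrite -[last x l]/(last x (x :: l)) -eqr last_rcons].
Qed.

Lemma online_sub o i j : uniq o -> i <= j -> B (take i o) \subset B (take j o).
Proof.
move=> uo ij; apply/subsetP => e ei.
have := subsetP (proj1 onB _) e ei; rewrite inE => eio.
have ejo : e \in take j o by rewrite -(take_takel o ij) in eio; exact: mem_take eio.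
by rewrite (online_take uo ejo) -(online_take uo eio).
Qed.

Lemma accepted_sub o s : uniq o -> accepted (rule B b) o s \subset B (take s o).
Proof.
by move=> uo; apply/subsetP => e; rewrite inE => /andP[es]; rewrite (ruleE uo es) => /andP[].
Qed.

Lemma accepted_rule o s : uniq o -> #|B (take s o)| <= b ->
  accepted (rule B b) o s = B (take s o).
Proof.
move=> uo le; apply/eqP; rewrite eqEsubset accepted_sub //; apply/subsetP => e eB.
have := subsetP (proj1 onB _) e eB; rewrite inE => es.
rewrite inE es (ruleE uo es) eB /=; apply: leq_trans le; apply: subset_leq_card.
by apply: online_sub => //; rewrite -in_take // (mem_take es).
Qed.

Lemma accepted_budget o s : uniq o -> #|accepted (rule B b) o s| <= b.
Proof.
move=> uo; elim: s => [|s IH].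
  rewrite (_ : accepted _ _ _ = set0) ?cards0 //; apply/setP => e.
  by rewrite !inE take0.
have [so|so] := leqP (size o) s.
  by move: IH; rewrite /accepted (take_oversize so) (take_oversize (leqW so)).
have [e0 _] : exists e : E, true by case: o so {uo IH} => // e; exists e.
pose e := nth e0 o s.
have ie : index e o = s by rewrite index_uniq.
have [re|re] := boolP (rule B b (take s.+1 o)).
  have es : e \in take s.+1 o by rewrite in_take ?mem_nth // ie.
  have := ruleE uo es; rewrite ie re => /esym/andP[_].
  by apply: leq_trans; apply: subset_leq_card; exact: accepted_sub.
apply: leq_trans IH; apply: subset_leq_card; apply/subsetP => e'.
rewrite !inE (take_nth e0) // mem_rcons inE => /andP[/orP[/eqP ->|->//]].
by rewrite -/e ie (negbTE re).
Qed.

End Online.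

Section BuiltOnline.
Variables (n d m r s1 s2 s3 : nat).
Hypotheses (s12 : s1 <= s2) (s23 : s2 <= s3).
Local Notation E := (edge n).
Implicit Types (h : seq E) (e : E).

Lemma greedy_online lab cp (l : seq E) e e' : e' != e ->
  (e' \in greedy lab cp (rcons l e)) = (e' \in greedy lab cp l).
Proof.
by move=> ne; rewrite greedy_rcons /grow; case: ok; rewrite // !inE (negbTE ne).
Qed.

Lemma greedy_nil lab cp : greedy lab cp [::] = set0 :> {set E}.
Proof. by []. Qed.

Lemma take_rcons h e a : a <= size h -> take a (rcons h e) = take a h.
Proof. by move=> ah; rewrite -cats1 takel_cat. Qed.

Lemma window_rcons h e a b :
  drop a (take b (rcons h e)) =
  if a <= size h < b then rcons (drop a (take b h)) e else drop a (take b h).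
Proof.
have [bh|bh] := leqP b (size h).
  by rewrite take_rcons // andbF.
have bh' : size (rcons h e) <= b by rewrite size_rcons.
rewrite andbT (take_oversize bh') (take_oversize (ltnW bh)).
have [ah|ah] := leqP a (size h); first by rewrite drop_rcons.
by rewrite (drop_oversize (ltnW ah)) drop_oversize // size_rcons.
Qed.

Lemma greedy_window (lab lab' : 'I_n -> nat) cp cp' a b h e e' : e' != e ->
  (a <= size h -> lab = lab' /\ cp = cp') ->
  (e' \in greedy lab cp (drop a (take b (rcons h e)))) =
  (e' \in greedy lab' cp' (drop a (take b h))).
Proof.
move=> ne eqh; rewrite window_rcons; have [ah|ah] := leqP a (size h).
  by have [<- <-] := eqh ah; case: ifP => // _; rewrite greedy_online.
have dn : drop a (take b h) = [::].
  by apply: drop_oversize; rewrite size_take_min geq_min (ltnW ah) orbT.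
by rewrite dn !greedy_nil.
Qed.

Lemma greedy_drop (lab lab' : 'I_n -> nat) cp cp' a h e e' : e' != e ->
  (a <= size h -> lab = lab' /\ cp = cp') ->
  (e' \in greedy lab cp (drop a (rcons h e))) = (e' \in greedy lab' cp' (drop a h)).
Proof.
move=> ne /(greedy_window (size h).+1 ne).
rewrite (@take_oversize _ _ (rcons h e)) ?size_rcons //.
by rewrite (@take_oversize _ _ h).
Qed.

Lemma built_online : online (built d m r s1 s2 s3 : seq E -> {set E}).
Proof.
have sub_drop a b h : [set e in drop a (take b h)] \subset [set e in h].
  by apply/subsetP => e; rewrite !inE => /mem_drop/mem_take.
split=> [h|h e e' uhe e'h].
  rewrite /built !subUset -!andbA; apply/and4P; split.
  - by apply/subsetP => e; rewrite !inE => /andP[/mem_take].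
  - exact: subset_trans (greedy_seen _ _ _) (sub_drop _ _ _).
  - exact: subset_trans (greedy_seen _ _ _) (sub_drop _ _ _).
  - apply: subset_trans (greedy_seen _ _ _) _.
    by apply/subsetP => e; rewrite !inE => /mem_drop.
have ne : e' != e by apply: contraTneq uhe => <-; rewrite rcons_uniq e'h.
have hE : take (size h) (rcons h e) = h by rewrite take_rcons // take_size.
have mainE : s3 <= size h -> main d m r s1 s2 s3 (rcons h e) = main d m r s1 s2 s3 h.
  by move=> sh; rewrite -(main_take _ _ _ s12 s23 (rcons h e) sh) hE.
have coreE : s1 <= size h -> core d m s1 (rcons h e) = core d m s1 h.
  by move=> sh; rewrite -(core_take _ _ (rcons h e) sh) hE.
have ballE : s2 <= size h -> ball d m s1 s2 (rcons h e) r = ball d m s1 s2 h r.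
  by move=> sh; rewrite -(ball_take _ _ s12 (rcons h e) _ sh) hE.
rewrite /built !in_setU; congr (_ || _); [congr (_ || _); [congr (_ || _)|]|].
- rewrite !inE; congr (_ && _); have [sh|sh] := leqP s1 (size h); first by rewrite take_rcons.
  have sh' : size (rcons h e) <= s1 by rewrite size_rcons.
  by rewrite (take_oversize sh') (take_oversize (ltnW sh)) mem_rcons inE e'h orbT.
- rewrite /chain; refine (@greedy_window _ _ _ _ _ _ _ _ _ ne _) => sh.
  split; [exact: erefl|exact: (congr1 (chain_cp d m) (coreE sh))].
- rewrite /repair /star /repair_seen; refine (@greedy_window _ _ _ _ _ _ _ _ _ ne _) => sh.
  rewrite (coreE (leq_trans s12 sh)) (ballE sh); split; exact: erefl.
rewrite /final /star; refine (@greedy_drop _ _ _ _ _ _ _ _ ne _) => sh.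
rewrite (mainE sh); split; exact: erefl.
Qed.

End BuiltOnline.

Section Deterministic.
Local Open Scope ring_scope.
Variables (R : realType) (n : nat).

Lemma measurable_unit_decision (f : seq (edge n) -> bool) (es : seq (edge n)) :
  measurable [set w : unit | f es]%classic.
Proof. by []. Qed.

Definition deterministic (f : seq (edge n) -> bool) : strategy R n :=
  @Strategy R n _ unit (\d_tt : probability unit R) (fun=> f) (measurable_unit_decision f).

Lemma prob_deterministic f s (Q : rel 'I_n -> bool) :
  prob_graph (deterministic f) s Q = Pr R (fun o => Q (adj (accepted f o s))).
Proof.
rewrite /prob_graph /Pr /Ex; congr (_ / _); apply: eq_bigr => o _.
transitivity (fine (dirac tt [set w : unit | Q (adj (accepted f o s))]%classic : \bar R)).
  by [].
rewrite diracE; case: (Q _); first by rewrite mem_set.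
by rewrite memNset.
Qed.

End Deterministic.

Section Estimates.
Local Open Scope ring_scope.
Variable R : realType.
Implicit Types (n w l : R).

Lemma expR2_ge (k : nat) : 2 ^+ k <= expR k%:R :> R.
Proof.
rewrite -[k%:R]mul1r expRM_natr; apply: lerXn2r; rewrite ?nnegrE ?expR_ge0 //.
by have := expR_ge1Dx (1 : R); lra.
Qed.

Lemma exp2V_le (k : nat) : 2 ^- k <= expR (- (k%:R / 2)) :> R.
Proof.
have -> : - (k%:R / 2) = (- 2^-1) * k%:R :> R by rewrite mulNr mulrC.
rewrite expRM_natr -exprVn; apply: lerXn2r; rewrite ?nnegrE ?expR_ge0 ?invr_ge0 //.
by have := expR_ge1Dx (- 2^-1 : R); lra.
Qed.

Lemma expN_le (u c : R) : 0 < c -> c^-1 <= u -> expR (- u) <= c.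
Proof.
move=> c0 cu; have u0 : 0 < u by apply: lt_le_trans cu; rewrite invr_gt0.
rewrite expRN -[leRHS]invrK lef_pV2 ?posrE ?expR_gt0 ?invr_gt0 //.
by apply: (le_trans cu); have := expR_ge1Dx u; lra.
Qed.

Lemma scaled_expN_le (C u c : R) : 0 < C -> 0 < c -> C / c <= u -> C * expR (- u) <= c.
Proof.
move=> C0 c0 Cu; rewrite mulrC -ler_pdivlMr //; apply: expN_le; first by rewrite divr_gt0.
by rewrite invf_div.
Qed.

Lemma ln_large (A : R) : exists n0 : nat, forall n : nat, (n0 <= n)%N ->
  A <= ln (n%:R : R) /\ A * ln (n%:R : R) <= n%:R.
Proof.
pose B := 4 * `|A| + 1.
have B0 : 0 < B by rewrite /B; have := normr_ge0 A; lra.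
exists (Num.truncn (expR B)).+1 => n nn.
have nB : expR B <= n%:R.
  apply: ltW; apply: lt_le_trans (truncnS_gt _) _; by rewrite ler_nat.
have n0 : (0 : R) < n%:R by apply: lt_le_trans nB; rewrite expR_gt0.
have lB : B <= ln (n%:R : R) by rewrite -[B]expRK ler_ln ?posrE ?expR_gt0.
set l := ln _ in lB *.
have AB : A <= B by rewrite /B; have := ler_norm A; have := normr_ge0 A; lra.
split; first exact: le_trans lB.
have nE : n%:R = expR l by rewrite /l lnK ?posrE.
have l0 : 0 < l by apply: lt_le_trans lB.
have h : (l / 2) ^+ 2 <= n%:R.
  rewrite nE -[in leRHS](@divfK _ 2 _ l) // expRM_natr.
  apply: lerXn2r; rewrite ?nnegrE ?expR_ge0 ?divr_ge0 ?(ltW l0) //.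
  by have := expR_ge1Dx (l / 2); lra.
apply: le_trans h; rewrite expr2.
have A4 : A <= l / 4 by have := ler_norm A; rewrite /B in lB; lra.
rewrite (_ : l / 2 * (l / 2) = l / 4 * l); last by field.
by rewrite ler_wpM2r // ltW.
Qed.

Lemma card_edge (n : nat) : #|edge n|%:R = n%:R * (n%:R - 1) / 2 :> R.
Proof.
have -> : #|edge n| = 'C(n, 2).
  rewrite card_sig -[in RHS](card_ord n) -card_draws.
  by apply: eq_card => A; rewrite !inE.
case: n => [|n]; first by rewrite bin0n /= mul0r mul0r.
rewrite bin2 -[n.+1.-1]/n; have -> : (n.+1%:R - 1 : R) = n%:R by rewrite -natr1 addrK.
rewrite -natrM -[in RHS](odd_double_half (n.+1 * n)).
have -> : odd (n.+1 * n) = false by rewrite oddM /= andbC; case: (odd n).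
by rewrite add0n -muln2 natrM mulfK.
Qed.

End Estimates.

(** * Asymptotics *)

Section Exponents.
Local Open Scope ring_scope.
Variable R : realFieldType.
Implicit Types (n l w y z c q N D S T K L Y : R).

Lemma core_exponent n w y K c L N :
  0 < n -> 0 < N -> 2 * N <= n * n -> 0 <= w -> w <= 2 * c * y -> n <= 2 * L * w ->
  K = 24 * L * (c * c) -> 0 <= L -> 3 * w <= 2^-1 * (y * y) / N * (K * n).
Proof.
move=> n0 N0 Nn w0 wy nw -> L0; rewrite mulrAC ler_pdivlMr //.
have h1 : 0 <= w * (n * n - 2 * N) by rewrite mulr_ge0 // subr_ge0.
have h2 : 0 <= w * n * (2 * L * w - n) by rewrite !mulr_ge0 ?subr_ge0 // ltW.
have h3 : 0 <= L * n * ((2 * c * y) * (2 * c * y) - w * w).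
  by rewrite !mulr_ge0 ?(ltW n0) // subr_ge0 ler_pM.
have -> : 2^-1 * (y * y) * (24 * L * (c * c) * n) = 12 * (L * n * (c * y * (c * y))) by field.
have -> : 3 * w * N = 3 * (w * N) by ring.
have e1 : w * (n * n - 2 * N) = w * n * n - 2 * (w * N) by ring.
have e2 : w * n * (2 * L * w - n) = 2 * (L * n * (w * w)) - w * n * n by ring.
have e3 : L * n * (2 * c * y * (2 * c * y) - w * w) =
  4 * (L * n * (c * y * (c * y))) - L * n * (w * w) by ring.
rewrite e1 in h1; rewrite e2 in h2; rewrite e3 in h3.
move: (w * n * n) (w * N) (L * n * (w * w)) (L * n * (c * y * (c * y))) h1 h2 h3.
by move=> a b e f; lra.
Qed.

Lemma base_exponent n w K c L D :
  0 < n -> 0 < D -> n * n <= 4 * D -> 0 <= w -> w * L <= n -> K = 24 * L * (c * c) ->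
  w * w / D * (K * n) <= 96 * (c * c) * w.
Proof.
move=> n0 D0 nD w0 wL ->; rewrite mulrAC ler_pdivrMr //.
have cc : 0 <= c * c by rewrite -expr2 sqr_ge0.
have cw : 0 <= c * c * w by rewrite mulr_ge0.
have h1 : 0 <= c * c * w * (4 * D - n * n) by rewrite mulr_ge0 ?subr_ge0.
have h2 : 0 <= c * c * w * n * (n - w * L).
  by rewrite mulr_ge0 ?subr_ge0 // mulr_ge0 // ltW.
have e1 : c * c * w * (4 * D - n * n) = 4 * (c * c * w * D) - c * c * w * n * n by ring.
have e2 : c * c * w * n * (n - w * L) = c * c * w * n * n - c * c * w * n * (w * L) by ring.
have -> : w * w * (24 * L * (c * c) * n) = 24 * (c * c * w * n * (w * L)) by ring.
have -> : 96 * (c * c) * w * D = 96 * (c * c * w * D) by ring.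
rewrite e1 in h1; rewrite e2 in h2.
move: (c * c * w * D) (c * c * w * n * n) (c * c * w * n * (w * L)) h1 h2 => a b e; lra.
Qed.

Lemma degree_exponent n l s D :
  0 < n -> 0 < D -> n * n <= 4 * D -> 0 <= l -> s <= n * l -> n / D * s <= 4 * l.
Proof.
move=> n0 D0 nD l0 sn; rewrite mulrAC ler_pdivrMr //.
apply: (@le_trans _ _ (n * (n * l))); first by rewrite ler_wpM2l // ltW.
by have := ler_wpM2l l0 nD; lra.
Qed.

Lemma unmet_exponent n l y q N S Y eta (d : R) :
  0 < n -> 0 < N -> 2 * N <= n * n -> 0 <= d -> 0 <= y -> 0 <= Y -> n <= 2 * Y * y ->
  y * y <= q -> eta * (n * l) / 2 <= S -> 8 * (Y * Y) * (2 * d + 1) <= eta * l ->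
  (2 * d + 1) * n <= 2^-1 * q / N * S.
Proof.
move=> n0 N0 Nn d0 y0 Y0 nY yq HS Hl; rewrite mulrAC ler_pdivlMr //.
have q0 : 0 <= q by apply: le_trans yq; rewrite mulr_ge0.
set D := 2 * d + 1 in Hl *; have D0 : 0 <= D by rewrite /D; lra.
have h1 : D * n * (2 * N) <= D * n * (n * n) by rewrite ler_wpM2l // mulr_ge0 // ltW.
have nn : n * n <= 4 * (Y * Y) * q.
  apply: (@le_trans _ _ ((2 * Y * y) * (2 * Y * y))); first by rewrite ler_pM // ltW.
  have -> : 2 * Y * y * (2 * Y * y) = 4 * (Y * Y) * (y * y) by ring.
  by rewrite ler_wpM2l // !mulr_ge0.
have h2 : D * n * (n * n) <= D * n * (4 * (Y * Y) * q).
  by rewrite ler_wpM2l // mulr_ge0 // ltW.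
have h3 : n * q * (8 * (Y * Y) * D) <= n * q * (eta * l).
  by rewrite ler_wpM2l // mulr_ge0 // ltW.
have h4 : q * (eta * (n * l) / 2) <= q * S by rewrite ler_wpM2l.
have e2 : D * n * (4 * (Y * Y) * q) = 4 * (n * q * (Y * Y) * D) by ring.
have e3 : n * q * (8 * (Y * Y) * D) = 8 * (n * q * (Y * Y) * D) by ring.
have e4 : q * (eta * (n * l) / 2) = n * q * (eta * l) / 2 by ring.
have e1 : D * n * (2 * N) = 2 * (D * n * N) by ring.
rewrite e1 in h1; rewrite e2 in h2; rewrite e3 in h3; rewrite e4 in h4.
have -> : 2^-1 * q * S = q * S / 2 by ring.
move: (D * n * N) (D * n * (n * n)) (n * q * (Y * Y) * D) (n * q * (eta * l)) (q * S) h1 h2 h3 h4.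
by move=> a b c e f; lra.
Qed.

Lemma path_exponent n l q N S L r eta :
  0 < n -> 0 < N -> 2 * N <= n * n -> 0 <= l -> 0 <= q -> 0 <= r -> n <= 8 * L * q ->
  eta * (n * l) / 2 <= S -> 32 * L <= r * eta -> 2 * l <= 2^-1 * (r * q) / N * S.
Proof.
move=> n0 N0 Nn l0 q0 r0 nq HS Hr; rewrite mulrAC ler_pdivlMr //.
have h1 : l * (2 * N) <= l * (n * n) by rewrite ler_wpM2l.
have h2 : l * n * n <= l * n * (8 * L * q) by rewrite ler_wpM2l // mulr_ge0 // ltW.
have h3 : l * n * q * (32 * L) <= l * n * q * (r * eta).
  by rewrite ler_wpM2l // !mulr_ge0 // ltW.
have h4 : r * q * (eta * (n * l) / 2) <= r * q * S by rewrite ler_wpM2l // mulr_ge0.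
have e1 : l * (2 * N) = 2 * (l * N) by ring.
have e5 : l * (n * n) = l * n * n by ring.
have e2 : l * n * (8 * L * q) = 8 * (l * n * q * L) by ring.
have e3 : l * n * q * (32 * L) = 32 * (l * n * q * L) by ring.
have e4 : r * q * (eta * (n * l) / 2) = l * n * q * (r * eta) / 2 by ring.
rewrite e1 e5 in h1; rewrite e2 in h2; rewrite e3 in h3; rewrite e4 in h4.
have -> : 2^-1 * (r * q) * S = r * q * S / 2 by ring.
have -> : 2 * l * N = 2 * (l * N) by ring.
move: (l * N) (l * n * n) (l * n * q * L) (l * n * q * (r * eta)) (r * q * S) h1 h2 h3 h4.
by move=> a b c e f; lra.
Qed.

Lemma final_exponent n l q N T eps :
  0 < n -> 0 < N -> 2 * N <= n * n -> 0 <= l -> 0 < eps <= 1 ->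
  (1 - eps / 16) * n <= q -> (1 + eps / 2) * (n * l) / 2 <= T ->
  (1 + eps / 4) * l <= (1 - eps / 16) * q / N * T.
Proof.
move=> n0 N0 Nn l0 /andP[e0 e1] nq HT; rewrite mulrAC ler_pdivlMr //.
have x0 : 0 <= 1 - eps / 16 by lra.
have h1 : (1 + eps / 4) * l * (2 * N) <= (1 + eps / 4) * l * (n * n).
  by rewrite ler_wpM2l // mulr_ge0 //; lra.
have h2 : (1 - eps / 16) * ((1 - eps / 16) * n) * ((1 + eps / 2) * (n * l) / 2) <=
    (1 - eps / 16) * q * T.
  apply: ler_pM => //.
  - by rewrite !mulr_ge0 // ltW.
  - by rewrite !mulr_ge0 // ?invr_ge0 ?(ltW n0) //; lra.
  - by rewrite ler_wpM2l.
have h3 : (1 + eps / 4) <= (1 - eps / 16) * (1 - eps / 16) * (1 + eps / 2) by nra.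
have ln0 : 0 <= l * (n * n) by rewrite !mulr_ge0 // ltW.
have h4 := ler_wpM2r ln0 h3.
have ea : (1 + eps / 4) * l * (2 * N) = 2 * ((1 + eps / 4) * l * N) by ring.
have eb : (1 + eps / 4) * l * (n * n) = (1 + eps / 4) * (l * (n * n)) by ring.
have ec : (1 - eps / 16) * ((1 - eps / 16) * n) * ((1 + eps / 2) * (n * l) / 2) =
  (1 - eps / 16) * (1 - eps / 16) * (1 + eps / 2) * (l * (n * n)) / 2 by ring.
rewrite ea eb in h1; rewrite ec in h2.
move: ((1 + eps / 4) * l * N) ((1 + eps / 4) * (l * (n * n)))
  ((1 - eps / 16) * (1 - eps / 16) * (1 + eps / 2) * (l * (n * n)))
  ((1 - eps / 16) * q * T) h1 h2 h4.
by move=> a b c f; lra.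
Qed.

End Exponents.

Section Constants.
Local Open Scope ring_scope.

Lemma budgetE (d n k w b L : nat) : (d * n + 2 * (k + d * (5 * w + 2 * b + L)) =
  d * n + 2 * (k + 5 * d * w) + 4 * (d * b) + 2 * (d * L))%N.
Proof. by rewrite !mulnDr !mulnA; lia. Qed.

Lemma truncn_lt (R : realType) (x : R) : x < (Num.truncn x)%:R + 1.
Proof. by rewrite natr1 truncnS_gt. Qed.

Variables (R : realType) (n d m r Ye : nat) (eps : R).
(* The exponents of the six terms of [Pr_built] are compared with [ln n] and [n];
   [eps * L] has to be large, then [r] is of order [L / eps], and [Y] makes the
   [r]-ball around the vertices with unmet demands a small fraction of [n]. *)
Local Notation L := (layers m).
Local Notation c := (2 * d + 3)%N.
Local Notation K := (24 * L * (c * c))%N.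
Local Notation Y := (d.+1 ^ r * (L * L * d) * Ye)%N.
Local Notation w := (width n m).
Local Notation eta := (eps / 32).
Local Notation l := (ln (n%:R : R)).
Local Notation N := #|edge n|.
Local Notation S := (Num.truncn (eta * (n%:R * l))).
Local Notation T := (Num.truncn ((1 + eps) * (n%:R * l / 2))).
Local Notation s1 := (K * n)%N.
Local Notation s2 := (s1 + S)%N.
Local Notation s3 := (s2 + S)%N.
Local Notation y := (n %/ Y)%N.
Local Notation y0 := (w %/ c)%N.
Local Notation z := (n %/ (16 * L))%N.
Local Notation k := (200 * (c * c) * w)%N.
Local Notation b := (d.+1 ^ r * (L * L * (d * y)))%N.
Local Notation M := (n - (b + w + L))%N.

Hypotheses (d2 : (1 < d)%N) (m2 : (1 < m)%N) (e0 : 0 < eps) (e1 : eps <= 1).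
Hypotheses (HL : (8 * (200 * (c * c) + 5 * d))%:R <= eps * L%:R)
  (Hr : 32 * L%:R <= r.+1%:R * eta) (HYe : (16 * d)%:R <= eps * Ye%:R).
Hypotheses (G1 : 1 <= l)
  (G2 : L%:R * (6 / eps + (8 * d.+1 + c + 2)%:R) <= n%:R)
  (G3 : 13 * (16 * L)%:R * l <= n%:R)
  (G4 : 4 * (Y%:R * Y%:R) * l <= n%:R)
  (G5 : 8 * (Y%:R * Y%:R) * (2 * d%:R + 1) <= eta * l) (G5' : 2 <= eta * l)
  (G6 : 32 * K%:R <= eps * l) (G6' : 32 <= eps * l) (G6'' : 2 * K%:R <= l)
  (G7 : 8 * l <= n%:R)
  (G8 : 64 * (L + d)%:R <= eps * n%:R) (G8' : 8 * (d * L)%:R <= eps * n%:R)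
  (G9 : (L * L)%:R / (eps / 6) <= n%:R)
  (G10 : (d ^ r)%:R * 2 ^+ (r.+1 * d) / (eps / 6) <= l)
  (G11 : (eps / 16) ^- d / (eps / 6) <= eps / 4 * l)
  (G12 : 6 / eps <= l).

Let nR : R := n%:R.
Let l0 : 0 < l. Proof. exact: lt_le_trans G1. Qed.
Let n8 : 8 <= nR. Proof. by apply: le_trans G7; rewrite ler_peMr. Qed.
Let n0 : 0 < nR. Proof. by apply: lt_le_trans n8. Qed.
Let nl1 : nR <= nR * l. Proof. by rewrite ler_peMr // ltW. Qed.

Lemma divn_bounds (a q : nat) : (0 < q)%N ->
  (a %/ q)%:R * q%:R <= a%:R :> R /\ a%:R < ((a %/ q)%:R + 1) * q%:R :> R.
Proof.
move=> q0; split; first by rewrite -natrM ler_nat leq_trunc_div.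
by rewrite natr1 -natrM ltr_nat ltn_ceil.
Qed.

Lemma natrL_gt0 : (0 : R) < L%:R. Proof. by rewrite ltr0n. Qed.
Let L0 := natrL_gt0.

Lemma width_large : 6 / eps + (8 * d.+1 + c)%:R <= w%:R :> R.
Proof.
have [_ h] := divn_bounds n (ltn0Sn (2 * m)).
have := le_lt_trans G2 h; rewrite mulrC ltr_pM2r // natrD => h1.
by rewrite -/(layers m) in h1; move: h1; rewrite -[(n %/ _)%:R]/(w%:R); lra.
Qed.

Let inv0 : 0 < 6 / eps. Proof. by rewrite divr_gt0. Qed.

Lemma width_ge : (8 * d.+1 + c <= w)%N.
Proof. by rewrite -(ler_nat R); have := width_large; have := inv0; lra. Qed.

Let w0 : (0 < w)%N. Proof. by apply: leq_trans width_ge; rewrite mulnS. Qed.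

Let wL : w%:R * L%:R <= nR. Proof. by have [] := divn_bounds n (ltn0Sn (2 * m)). Qed.

Let nw : nR <= 2 * L%:R * w%:R.
Proof.
have [_ h] := divn_bounds n (ltn0Sn (2 * m)); apply: (le_trans (ltW h)).
have w1 : (1 : R) <= w%:R by rewrite ler1n.
rewrite -/(layers m) -[(n %/ _)%:R]/(w%:R) mulrDl mul1r.
have := ler_wpM2r (ltW L0) w1; rewrite mul1r; lra.
Qed.

Let Ye0 : (0 < Ye)%N.
Proof.
rewrite lt0n; apply/eqP => E; move: HYe; rewrite E mulr0 lern0 muln_eq0 /=.
by move: d2; case: (d).
Qed.

Let Y0 : (0 < Y)%N.
Proof. by rewrite !muln_gt0 expn_gt0 /= Ye0 (ltnW d2). Qed.

Let YR : (1 : R) <= Y%:R. Proof. by rewrite ler1n. Qed.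

Let YY : Y%:R <= Y%:R * Y%:R :> R. Proof. by rewrite ler_peMr. Qed.

Let Yn : 4 * Y%:R <= nR.
Proof.
apply: le_trans G4; have := ler_wpM2l (_ : 0 <= 4 * (Y%:R * Y%:R)) G1.
rewrite mulr1 !mulr_ge0 // => /(_ isT); have := YY; lra.
Qed.

Let y_gt0 : (0 < y)%N.
Proof. by rewrite divn_gt0 // -(ler_nat R); have := YR; have := Yn; rewrite /nR; lra. Qed.

Let nY : nR <= 2 * Y%:R * y%:R.
Proof.
have [_ h] := divn_bounds n Y0; apply: (le_trans (ltW h)).
have w1 : (1 : R) <= y%:R by rewrite ler1n.
have := ler_wpM2r (ltW (lt_le_trans ltr01 YR)) w1; rewrite mul1r mulrDl mul1r; lra.
Qed.

Let yY : y%:R * Y%:R <= nR. Proof. by have [] := divn_bounds n Y0. Qed.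

Let y0_gt0 : (0 < y0)%N.
Proof. by rewrite divn_gt0 ?addn3 // -addn3 (leq_trans _ width_ge) // leq_addl. Qed.

Let wy0 : w%:R <= 2 * c%:R * y0%:R :> R.
Proof.
have c0 : (0 < c)%N by rewrite addn3.
have [_ h] := divn_bounds w c0; apply: (le_trans (ltW h)).
have w1 : (1 : R) <= y0%:R by rewrite ler1n.
have cR : (0 : R) <= c%:R by [].
have := ler_wpM2r cR w1; rewrite mul1r mulrDl mul1r; lra.
Qed.

Let zL : 16 * L%:R * z%:R <= nR.
Proof.
have q0 : (0 < 16 * L)%N by rewrite muln_gt0.
by have [h _] := divn_bounds n q0; rewrite natrM mulrC in h.
Qed.

Let zl : 12 * l <= z%:R.
Proof.
have q0 : (0 < 16 * L)%N by rewrite muln_gt0.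
have [_ h] := divn_bounds n q0; have := le_lt_trans G3 h.
have q0R : (0 : R) < (16 * L)%:R by rewrite ltr0n.
by rewrite mulrAC ltr_pM2r // => h1; have := G1; lra.
Qed.

Let zw : (8 * z <= w)%N.
Proof.
rewrite -(ler_nat R) natrM -(ler_pM2l L0) -(ler_pM2l (ltr0Sn R 1)).
by have := zL; have := nw; lra.
Qed.

Let NE : 2 * N%:R = nR * nR - nR.
Proof. by rewrite card_edge -/nR mulrBr mulr1 mulrC divfK. Qed.

Let N0 : (0 : R) < N%:R.
Proof. by have := ler_wpM2l (ltW n0) n8; have := NE; have := n0; lra. Qed.

Let Nn : 2 * N%:R <= nR * nR.
Proof. by have := NE; have := n0; lra. Qed.

Let nl8 : 8 * (nR * l) <= nR * nR.
Proof. by have := ler_wpM2l (ltW n0) G7; rewrite -/nR; lra. Qed.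

Let nn8 : 8 * nR <= nR * nR.
Proof. by have := ler_wpM2l (ltW n0) n8; lra. Qed.

Let S_le : S%:R <= eta * (nR * l).
Proof. by rewrite truncn_le // !mulr_ge0 ?invr_ge0 // ?ltW. Qed.

Let etanl : 2 <= eta * (nR * l).
Proof.
have h : 0 <= eta * l by apply: le_trans G5'.
have := ler_wpM2r h (_ : 1 <= nR); rewrite mul1r mulrCA; have := n8 => n8' /(_ _).
have n1 : 1 <= nR by lra. by move=> /(_ n1); have := G5'; lra.
Qed.

Let S_ge : eta * (nR * l) / 2 <= S%:R.
Proof. by have := truncn_lt (eta * (nR * l)); rewrite -/nR; have := etanl; lra. Qed.

Let eta_le : eta * (nR * l) <= nR * l / 32.
Proof.
have h : 0 <= nR * l by rewrite mulr_ge0 // ltW.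
by have := ler_wpM2r h e1; lra.
Qed.

Let s1_le : 2 * s1%:R <= nR * l.
Proof.
by have := ler_wpM2l (ltW n0) G6''; rewrite natrM -/nR; lra.
Qed.

Let s1_eps : 32 * s1%:R <= eps * (nR * l).
Proof.
by have := ler_wpM2l (ltW n0) G6; rewrite natrM -/nR; lra.
Qed.

Let s2_le : s2%:R <= nR * l.
Proof. by rewrite natrD; have := s1_le; have := S_le; have := eta_le; have := nl1; have := n0; lra. Qed.

Let s3_le : s3%:R <= nR * l.
Proof.
by rewrite !natrD; have := s1_le; have := S_le; have := eta_le; have := nl1; have := n0; lra.
Qed.

Let s3N : (s3 < N)%N.
Proof.
by rewrite -(ltr_nat R); have := s3_le; have := NE; have := nl8; have := nn8; have := n0; lra.
Qed.

Let Tb0 : 0 <= (1 + eps) * (nR * l / 2).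
Proof. by rewrite !mulr_ge0 ?invr_ge0 // ?ltW // addr_gt0. Qed.

Let T_ge : (1 + eps / 2) * (nR * l) / 2 <= (T - s3)%N%:R.
Proof.
have h := truncn_lt ((1 + eps) * (nR * l / 2)); rewrite -/nR in h.
have h2 : 32 <= eps * (nR * l).
  have hh : 0 <= eps * l by apply: le_trans G6'.
  have n1 : 1 <= nR by have := n8; lra.
  have := ler_wpM2r hh n1; rewrite mul1r mulrCA; have := G6'; lra.
have h3 : (T - s3)%N%:R >= T%:R - s3%:R :> R.
  have [le|lt] := leqP s3 T; first by rewrite natrB.
  have -> : (T - s3 = 0)%N by apply/eqP; rewrite subn_eq0 ltnW.
  by rewrite subr_le0 ler_nat ltnW.
have h4 : s3%:R <= eps * (nR * l) / 32 + 2 * (eps / 32 * (nR * l)).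
  by rewrite !natrD; have := S_le; have := s1_eps; lra.
apply: le_trans h3; move: h h2 h4; set nl := nR * l; set TT := T%:R; set ss := s3%:R.
have -> : (1 + eps) * (nl / 2) = nl / 2 + eps * nl / 2 by ring.
have -> : (1 + eps / 2) * nl / 2 = nl / 2 + eps * nl / 4 by field.
have -> : eps / 32 * nl = eps * nl / 32 by ring.
by move: (eps * nl) => en; lra.
Qed.

Let s3T : (s3 <= T)%N.
Proof.
rewrite leqNgt; apply/negP => lt; have := T_ge.
have -> : (T - s3 = 0)%N by apply/eqP; rewrite subn_eq0 ltnW.
apply/negP; rewrite -ltNge mulr_gt0 // ?mulr_gt0 // ?addr_gt0 // divr_gt0 //.
Qed.

Let TN : (T <= N)%N.
Proof.
rewrite -(ler_nat R); have h : T%:R <= (1 + eps) * (nR * l / 2) by rewrite truncn_le.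
have nl0 : 0 <= nR * l / 2 by rewrite !mulr_ge0 ?invr_ge0 // ltW.
have := ler_wpM2r nl0 e1; move: h NE nl8 nn8.
have -> : (1 + eps) * (nR * l / 2) = nR * l / 2 + eps * (nR * l / 2) by ring.
have := n0; lra.
Qed.

Let ND (s : nat) : (s <= s3)%N -> 0 < (N - s)%N%:R :> R /\ nR * nR <= 4 * (N - s)%N%:R.
Proof.
move=> ss; have sN : (s <= N)%N by rewrite (leq_trans ss) // ltnW.
rewrite natrB //; have sR : s%:R <= s3%:R :> R by rewrite ler_nat.
have := NE; have := s3_le; have := nl8; have := nn8; have := n0.
by move=> *; split; lra.
Qed.

Let Ye_b : b%:R * Ye%:R <= nR.
Proof.
apply: le_trans yY; rewrite -!natrM ler_nat; apply: eq_leq; ring.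
Qed.

Let b_le : 16 * d%:R * b%:R <= eps * nR.
Proof.
have h := ler_wpM2l (ltW e0) Ye_b; have bR : (0 : R) <= b%:R by [].
have h2 := ler_wpM2l bR HYe; rewrite [(16 * d)%:R]natrM in h2.
by move: (b%:R : R) h h2 => b'; lra.
Qed.

Let d2R : (2 : R) <= d%:R. Proof. by rewrite ler_nat. Qed.

Let kw_le : 8 * (k + 5 * d * w)%:R <= eps * nR.
Proof.
have wR : (0 : R) <= w%:R by [].
have h := ler_wpM2r wR HL.
have h2 := ler_wpM2l (ltW e0) wL.
rewrite (_ : (k + 5 * d * w = (200 * (c * c) + 5 * d) * w)%N); last by rewrite [RHS]mulnDl.
move: h h2; rewrite [(8 * _)%:R]natrM [(_ * w)%:R]natrM.
by move: ((200 * (c * c) + 5 * d)%:R : R) (w%:R : R) => A w'; lra.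
Qed.

Lemma budget_le : (d * n + 2 * (k + d * (5 * w + 2 * b + L)))%N%:R <= (1 + eps) * (d%:R * nR).
Proof.
have castE (A B C D : nat) : (A + 2 * B + 4 * C + 2 * D)%N%:R =
    A%:R + 2 * B%:R + 4 * C%:R + 2 * D%:R :> R by rewrite 3!natrD !natrM.
rewrite budgetE castE [(d * n)%N%:R]natrM [(d * b)%N%:R]natrM -/nR.
have h2 : eps * nR * 2 <= eps * nR * d%:R by rewrite ler_wpM2l // mulr_ge0 // ltW.
have h1 := kw_le; have h3 := b_le; have h4 := G8'; rewrite -/nR in h4.
have en : 0 <= eps * nR by rewrite mulr_ge0 // ltW.
move: h1 h2 h3 h4 en; have -> : (1 + eps) * (d%:R * nR) = d%:R * nR + eps * nR * d%:R by ring.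
move: (eps * nR) ((k + 5 * d * w)%N%:R : R) ((d * L)%N%:R : R) => en A B.
rewrite -mulrA; move: (d%:R * b%:R : R) (d%:R * nR) (en * d%:R) => C D F; lra.
Qed.

Let loss_le : (b + w + L + (z + d))%:R <= eps / 16 * nR.
Proof.
have c7 : (7 <= c)%N by move: d2; clear; lia.
have cc : (49 <= c * c)%N by exact: (leq_mul c7 c7).
have big : (1600 <= 200 * (c * c) + 5 * d)%N.
  by move: (c * c)%N cc => C; clear; lia.
have h1 : 1600 * w%:R <= eps * nR.
  apply: le_trans kw_le; rewrite (_ : (k + 5 * d * w = (200 * (c * c) + 5 * d) * w)%N).
    2: by rewrite [RHS]mulnDl.
  have wR : (0 : R) <= w%:R by [].
  have bigR : (1600 : R) <= (200 * (c * c) + 5 * d)%:R by rewrite ler_nat.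
  rewrite [(_ * w)%:R]natrM; have := ler_wpM2r wR bigR.
  have := ler_wpM2r wR (ler0n R (200 * (c * c) + 5 * d)); rewrite mul0r.
  by move: (_ * w%:R) (1600 * _) => A B; lra.
have L1600 : 1600 <= eps * L%:R.
  apply: le_trans HL; rewrite ler_nat; apply: leq_trans big _; exact: leq_pmull.
have h2 : 1600 * z%:R <= eps * nR.
  have zR : (0 : R) <= z%:R by [].
  have := ler_wpM2r zR L1600; have := ler_wpM2l (ltW e0) zL; lra.
have h3 : 32 * b%:R <= eps * nR.
  apply: le_trans b_le; rewrite ler_wpM2r //; have := d2R; lra.
move: G8; rewrite -/nR; have -> : (b + w + L + (z + d))%:R =
  b%:R + w%:R + (L + d)%:R + z%:R :> R.
  by rewrite !natrD; move: (b%:R : R) (w%:R : R) (L%:R : R) (z%:R : R) (d%:R : R); clear => *; ring.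
have -> : eps / 16 * nR = eps * nR / 16 by ring.
have en : 0 <= eps * nR by rewrite mulr_ge0 // ltW.
move: en h1 h2 h3; move: (b%:R : R) (w%:R : R) (z%:R : R) ((L + d)%:R : R) (eps * nR).
by move=> *; lra.
Qed.

Let loss_n : (b + w + L + (z + d) <= n)%N.
Proof.
rewrite -(ler_nat R); apply: le_trans loss_le _; rewrite -/nR ler_piMl ?(ltW n0) //.
have := e1; lra.
Qed.

Let M_ge : (1 - eps / 16) * nR <= (M - (z + d))%N%:R.
Proof.
have -> : (M - (z + d) = n - (b + w + L + (z + d)))%N by rewrite [RHS]subnDA.
by rewrite natrB ?loss_n // -/nR; have := loss_le; lra.
Qed.

Let s2_y : (s2 <= y * y)%N.
Proof.
rewrite -(ler_nat R); apply: (le_trans s2_le).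
have n4 : nR * nR <= 4 * (Y%:R * Y%:R) * (y * y)%:R.
  apply: (@le_trans _ _ ((2 * Y%:R * y%:R) * (2 * Y%:R * y%:R))).
    by rewrite ler_pM // ltW.
  by rewrite natrM le_eqVlt; apply/orP; left; apply/eqP; ring.
have YYp : 0 < 4 * (Y%:R * Y%:R) :> R.
  by rewrite mulr_gt0 // mulr_gt0 // (lt_le_trans ltr01).
rewrite -(ler_pM2l YYp); apply: le_trans n4.
by have := ler_wpM2l (ltW n0) G4; rewrite -/nR; lra.
Qed.

Let q4 : (y * y)%:R <= (d * y * y - s2)%N%:R :> R.
Proof.
rewrite ler_nat leq_subRL; last first.
  by apply: leq_trans s2_y _; rewrite leq_mul2r leq_pmull ?orbT // ltnW.
have -> : (d * y * y = d * (y * y))%N by rewrite [RHS]mulnA.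
by move: s2_y (leq_mul d2 (leqnn (y * y))); move: (s2) (y * y)%N (d * (y * y))%N => a b' c'; clear; lia.
Qed.

Let q5 : nR <= 8 * L%:R * (w./2 - (z + d))%N%:R.
Proof.
have h : (w <= 4 * (w./2 - (z + d)))%N.
  by move: zw width_ge; move: (w) (z) => w' z'; clear; lia.
apply: (le_trans nw).
have hR : w%:R <= 4 * (w./2 - (z + d))%N%:R :> R by rewrite -natrM ler_nat.
by have := ler_wpM2l (ltW L0) hR; lra.
Qed.

Lemma failure_le :
  Pr R (fun o : seq (edge n) =>
      ~~ (kconn d (adj (built d m r s1 s2 s3 (take T o))) [set: 'I_n] &&
          (2 * #|built d m r s1 s2 s3 (take T o)| <= d * n + 2 * (k + d * (5 * w + 2 * b + L)))%N))
  <= eps.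
Proof.
have x01 : 0 < eps / 16 <= 1 by apply/andP; split; [rewrite divr_gt0|have := e1; lra].
have y0w : (c * y0 <= w)%N by rewrite mulnC leq_trunc_div.
have yw : (2 * y <= w)%N.
  rewrite -(ler_nat R) natrM -(ler_pM2l L0).
  have h : 4 * L%:R <= Y%:R :> R.
    rewrite -natrM ler_nat -!mulnA; apply: leq_trans (leq_pmull _ _); last by rewrite expn_gt0.
    rewrite mulnC leq_mul2l /=; apply: leq_trans (leq_pmulr _ _); last by rewrite muln_gt0 Ye0 ltnW.
    by rewrite /layers; move: m2; clear; lia.
  have yR : (0 : R) <= y%:R by [].
  by have := ler_wpM2r yR h; have := yY; have := nw; lra.
have Mn : (M + (b + w + L) <= n)%N.
  by rewrite subnK //; apply: leq_trans loss_n; rewrite leq_addr.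
have s12 : (s1 <= s2)%N by rewrite leq_addr.
have s23 : (s2 <= s3)%N by rewrite leq_addr.
have PB := @Pr_built R n d m r s1 s2 s3 d2 m2 w0 s12 s23 s3N k y0 y z M T (eps / 16)
  y0_gt0 y0w y_gt0 yw Mn x01 s3T TN.
apply: (le_trans PB).
have c6 : 0 < eps / 6 by rewrite divr_gt0.
have s21 : (s2 - s1 = S)%N by rewrite addKn.
have s32 : (s3 - s2 = S)%N by rewrite addKn.
rewrite s21 s32.
have [D1 D1n] := ND (leq_trans s12 s23); have [D3 D3n] := ND (leqnn s3).
have LR : (0 : R) <= L%:R by [].
have KE : K%:R = 24 * L%:R * (c%:R * c%:R) :> R by rewrite !natrM.
have q1 : 4 ^+ w * expR (- (2^-1 * (y0 * y0)%:R / N%:R * s1%:R)) <= eps / 6.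
  have ex := core_exponent n0 N0 Nn (ler0n _ w) wy0 nw KE LR.
  apply: (@le_trans _ _ (expR (2 * w%:R) * expR (- (3 * w%:R)))).
    apply: ler_pM; rewrite ?exprn_ge0 ?expR_ge0 //.
      rewrite (_ : 4 ^+ w = 2 ^+ (2 * w)); last by rewrite exprM; congr (_ ^+ w); rewrite -natrX.
      by apply: le_trans (expR2_ge _ _) _; rewrite natrM.
    by rewrite ler_expR lerN2 [(y0 * y0)%:R]natrM [s1%:R]natrM.
  rewrite -expRD (_ : 2 * w%:R + - (3 * w%:R) = - w%:R); last by ring.
  apply: expN_le => //; rewrite invf_div; have := width_large.
  by have : (0 : R) <= (8 * d.+1 + c)%:R by []; lra.
have q2 : 2 ^- k * expR ((w * w)%:R / (N - s1)%N%:R * s1%:R) <= eps / 6.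
  have ex := base_exponent n0 D1 D1n (ler0n _ w) wL KE.
  apply: (@le_trans _ _ (expR (- (k%:R / 2)) * expR (96 * (c%:R * c%:R) * w%:R))).
    apply: ler_pM; rewrite ?invr_ge0 ?exprn_ge0 ?expR_ge0 //; first exact: exp2V_le.
    by rewrite ler_expR [(w * w)%:R]natrM [s1%:R]natrM.
  rewrite -expRD; apply: (@le_trans _ _ (expR (- w%:R))).
    rewrite ler_expR [k%:R]natrM [(200 * _)%:R]natrM [(c * c)%:R]natrM.
    have cR : (1 : R) <= c%:R by rewrite ler1n addn3.
    have cc : (1 : R) <= c%:R * c%:R by rewrite mulr_ege1.
    have wR : (0 : R) <= w%:R by [].
    by have := ler_wpM2r wR cc; lra.
  apply: expN_le => //; rewrite invf_div; have := width_large.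
  by have : (0 : R) <= (8 * d.+1 + c)%:R by []; lra.
have nE : nR = expR l by rewrite lnK ?posrE.
have q3 : n%:R * (2 ^- z * expR (n%:R / (N - s3)%N%:R * s3%:R)) <= eps / 6.
  have ex := degree_exponent n0 D3 D3n (ltW l0) s3_le.
  apply: (@le_trans _ _ (expR l * (expR (- (z%:R / 2)) * expR (4 * l)))).
    rewrite -/nR {1}nE; apply: ler_wpM2l; first exact: expR_ge0.
    apply: ler_pM; rewrite ?invr_ge0 ?exprn_ge0 ?expR_ge0 //; first exact: exp2V_le.
    by rewrite ler_expR.
  rewrite -!expRD; apply: (@le_trans _ _ (expR (- l))).
    by rewrite ler_expR; have := zl; lra.
  by apply: expN_le => //; rewrite invf_div.
have q4' : (L * L)%:R * (2 ^+ (2 * d * n) *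
       expR (- (2^-1 * (d * y * y - s2)%:R / N%:R * S%:R))) <= eps / 6.
  have yyq : y%:R * y%:R <= (d * y * y - s2)%N%:R :> R by rewrite -natrM; exact: q4.
  have ex := unmet_exponent n0 N0 Nn (ler0n _ d) (ler0n _ y) (ler0n _ Y) nY yyq S_ge G5.
  apply: (@le_trans _ _ ((L * L)%:R * expR (- nR))).
    apply: ler_wpM2l => //.
    apply: (@le_trans _ _ (expR (2 * d%:R * nR) * expR (- ((2 * d%:R + 1) * nR)))).
      apply: ler_pM; rewrite ?exprn_ge0 ?expR_ge0 //.
        by apply: le_trans (expR2_ge _ _) _; rewrite !natrM.
      by rewrite ler_expR lerN2.
    by rewrite -expRD ler_expR; lra.
  by apply: scaled_expN_le => //; rewrite ltr0n muln_gt0.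
have q5' : (n * d ^ r)%:R * (2 ^+ (r.+1 * d) *
       expR (- (2^-1 * (r.+1 * (w./2 - (z + d)))%:R / N%:R * S%:R))) <= eps / 6.
  have ex := path_exponent n0 N0 Nn (ltW l0) (ler0n _ (w./2 - (z + d))) (ler0n _ r.+1) q5 S_ge Hr.
  apply: (@le_trans _ _ ((d ^ r)%:R * 2 ^+ (r.+1 * d) * expR (- l))).
    rewrite natrM mulrAC -mulrA [X in X <= _](_ : _ = (d ^ r)%:R * 2 ^+ (r.+1 * d) *
       (n%:R * expR (- (2^-1 * (r.+1 * (w./2 - (z + d)))%:R / N%:R * S%:R)))); last by ring.
    apply: ler_wpM2l; first by rewrite mulr_ge0 // exprn_ge0.
    rewrite -/nR {1}nE -expRD ler_expR [(r.+1 * _)%:R]natrM; lra.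
  by apply: scaled_expN_le => //; rewrite mulr_gt0 ?exprn_gt0 // ltr0n expn_gt0 ltnW.
have q6' : n%:R * ((eps / 16) ^- d *
    expR (- ((1 - eps / 16) * (M - (z + d))%:R / N%:R * (T - s3)%:R))) <= eps / 6.
  have e01 : 0 < eps <= 1 by rewrite e0.
  have ex := final_exponent n0 N0 Nn (ltW l0) e01 M_ge T_ge.
  have x0 : 0 < (eps / 16) ^- d by rewrite invr_gt0 exprn_gt0 // divr_gt0.
  apply: (@le_trans _ _ ((eps / 16) ^- d * expR (- (eps / 4 * l)))); last first.
    exact: scaled_expN_le.
  rewrite mulrCA; apply: ler_wpM2l; first exact: ltW.
  by rewrite -/nR {1}nE -expRD ler_expR; lra.
apply: le_trans (lerD q1 (lerD q2 (lerD q3 (lerD q4' (lerD q5' q6'))))) _.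
by lra.
Qed.

End Constants.

Section Asymptotics.
Local Open Scope ring_scope.
Variables (R : realType) (d : nat).
Hypothesis d2 : (1 < d)%N.

Lemma exists_natM (a eps : R) : 0 < eps -> 0 <= a -> exists q : nat, a <= eps * q%:R.
Proof.
move=> e0 a0; exists (Num.truncn (a / eps)).+1.
by rewrite mulrC -ler_pdivrMr // -natr1 ltW // truncn_lt.
Qed.

Lemma le_foldr_max (s : seq R) : all (fun a => a <= foldr Num.max 1 s) s.
Proof.
elim: s => //= a s IH; rewrite le_max lexx /=; apply: sub_all IH => x /=.
by rewrite le_max => ->; rewrite orbT.
Qed.

Lemma foldr_max_ge1 (s : seq R) : 1 <= foldr Num.max 1 s.
Proof. by elim: s => //= a s IH; rewrite le_max IH orbT. Qed.

Lemma good_rule (eps : R) : 0 < eps -> eps <= 1 -> exists n0 : nat, forall n : nat,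
  (n0 <= n)%N -> exists f : seq (edge n) -> bool,
    (forall (o : seq (edge n)) (s : nat), uniq o ->
       #|accepted f o s|%:R <= (1 + eps) * (d%:R * n%:R / 2)) /\
    1 - eps <= Pr R (fun o => d_connected d
       (adj (accepted f o (Num.truncn ((1 + eps) * (n%:R * ln n%:R / 2)))))).
Proof.
move=> e0 e1.
pose c := (2 * d + 3)%N.
have [q Hq] := exists_natM e0 (ler0n R (8 * (200 * (c * c) + 5 * d))).
pose m := q.+2; have m2 : (1 < m)%N by [].
pose L := layers m.
have HL : (8 * (200 * (c * c) + 5 * d))%:R <= eps * L%:R.
  apply: le_trans Hq _; apply: ler_wpM2l; first exact: ltW.
  by rewrite ler_nat /L /layers /m; clear; lia.
have eta0 : 0 < eps / 32 by rewrite divr_gt0.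
have L32 : 0 <= 32 * L%:R :> R by rewrite mulr_ge0.
have [r Hr'] := exists_natM eta0 L32.
have Hr : 32 * L%:R <= r.+1%:R * (eps / 32).
  by apply: le_trans Hr' _; rewrite mulrC; apply: ler_wpM2r; [exact: ltW|rewrite ler_nat].
have [Ye HYe] := exists_natM e0 (ler0n R (16 * d)).
pose K := (24 * L * (c * c))%N; pose Y := (d.+1 ^ r * (L * L * d) * Ye)%N.
pose s : seq R := [:: L%:R * (6 / eps + (8 * d.+1 + c + 2)%:R); 13 * (16 * L)%:R;
  4 * (Y%:R * Y%:R); 8 * (Y%:R * Y%:R) * (2 * d%:R + 1) / (eps / 32); 2 / (eps / 32);
  32 * K%:R / eps; 32 / eps; 2 * K%:R; 8; 64 * (L + d)%:R / eps; 8 * (d * L)%:R / eps;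
  (L * L)%:R / (eps / 6); (d ^ r)%:R * 2 ^+ (r.+1 * d) / (eps / 6);
  (eps / 16) ^- d / (eps / 6) / (eps / 4); 6 / eps].
pose A := foldr Num.max 1 s.
have A1 : 1 <= A by exact: foldr_max_ge1.
have sA a : a \in s -> a <= A by move=> as_; exact: (allP (le_foldr_max s)).
have [n0 Hn0] := ln_large A; exists n0 => n nn0.
have [Al Aln] := Hn0 n nn0; set l := ln (n%:R : R) in Al Aln.
have G1 : 1 <= l by apply: le_trans Al.
have l0 : 0 <= l by apply: le_trans G1.
have An : A <= n%:R by apply: le_trans Aln; rewrite ler_peMr // (le_trans ler01).
have sl a : a \in s -> a <= l by move=> /sA/le_trans; apply.
have sn a : a \in s -> a <= n%:R by move=> /sA/le_trans; apply.
have sln a : a \in s -> a * l <= n%:R.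
  by move=> /sA aA; apply: le_trans Aln; rewrite ler_wpM2r.
have e4 : 0 < eps / 4 by rewrite divr_gt0.
have G2 : L%:R * (6 / eps + (8 * d.+1 + c + 2)%:R) <= n%:R by apply: sn; rewrite !inE eqxx ?orbT.
have G3 : 13 * (16 * L)%:R * l <= n%:R by apply: sln; rewrite !inE eqxx ?orbT.
have G4 : 4 * (Y%:R * Y%:R) * l <= n%:R by apply: sln; rewrite !inE eqxx ?orbT.
have G5 : 8 * (Y%:R * Y%:R) * (2 * d%:R + 1) <= eps / 32 * l.
  by rewrite [leRHS]mulrC -ler_pdivrMr // sl // !inE eqxx ?orbT.
have G5' : 2 <= eps / 32 * l.
  by rewrite [leRHS]mulrC -ler_pdivrMr // sl // !inE eqxx ?orbT.
have G6 : 32 * K%:R <= eps * l by rewrite [leRHS]mulrC -ler_pdivrMr // sl // !inE eqxx ?orbT.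
have G6' : 32 <= eps * l by rewrite [leRHS]mulrC -ler_pdivrMr // sl // !inE eqxx ?orbT.
have G6'' : 2 * K%:R <= l by rewrite sl // !inE eqxx ?orbT.
have G7 : 8 * l <= n%:R by apply: sln; rewrite !inE eqxx ?orbT.
have G8 : 64 * (L + d)%:R <= eps * n%:R.
  by rewrite [leRHS]mulrC -ler_pdivrMr // sn // !inE eqxx ?orbT.
have G8' : 8 * (d * L)%:R <= eps * n%:R.
  by rewrite [leRHS]mulrC -ler_pdivrMr // sn // !inE eqxx ?orbT.
have G9 : (L * L)%:R / (eps / 6) <= n%:R by apply: sn; rewrite !inE eqxx ?orbT.
have G10 : (d ^ r)%:R * 2 ^+ (r.+1 * d) / (eps / 6) <= l.
  by apply: sl; rewrite !inE eqxx ?orbT.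
have G11 : (eps / 16) ^- d / (eps / 6) <= eps / 4 * l.
  by rewrite [leRHS]mulrC -ler_pdivrMr // sl // !inE eqxx ?orbT.
have G12 : 6 / eps <= l by apply: sl; rewrite !inE eqxx ?orbT.
have fl := failure_le d2 m2 e0 e1 HL Hr HYe G1 G2 G3 G4 G5 G5' G6 G6' G6'' G7 G8 G9 G10 G11 G12.
have bl := budget_le r d2 e0 HL HYe G8'.
have wg := width_ge e0 G2.
move: fl bl; set bnat := (d * n + _)%N; set t := Num.truncn ((1 + eps) * _).
set s1 := (_ * n)%N; set S := Num.truncn _; set B := built d m r s1 (s1 + S) (s1 + S + S).
move=> fl bl.
have onB : online B by apply: built_online; rewrite leq_addr.
have b0 : 0 <= (1 + eps) * (d%:R * n%:R / 2) by rewrite !mulr_ge0 ?invr_ge0 // addr_ge0 // ltW.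
exists (rule B (Num.truncn ((1 + eps) * (d%:R * n%:R / 2)))); split=> [es k ues | ].
  by rewrite -truncn_ge_nat // accepted_budget.
have : 1 - eps <= 1 - Pr R (fun o => ~~ (kconn d (adj (B (take t o))) [set: 'I_n] &&
    (2 * #|B (take t o)| <= bnat)%N)) by rewrite lerD2l lerN2.
move/le_trans; apply; rewrite -PrC; apply: Pr_sub => o uo /=; rewrite negbK => /andP[kB cB].
have le : (#|B (take t o)| <= Num.truncn ((1 + eps) * (d%:R * n%:R / 2)))%N.
  rewrite truncn_ge_nat //; have : (2 * #|B (take t o)|)%:R <= (1 + eps) * (d%:R * n%:R).
    by apply: le_trans bl; rewrite ler_nat.
  rewrite natrM; move: (#|_|%:R : R) (d%:R * n%:R) => x y; lra.
rewrite (accepted_rule onB uo le) /d_connected card_ord; apply/andP; split.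
  apply: leq_trans (leq_trans wg (leq_div _ _)); rewrite mulSn -addnA; exact: leq_addr.
apply/forallP => S'; apply/implyP => S'd; have := implyP (forallP kB S') S'd.
by rewrite setTD.
Qed.

End Asymptotics.

Local Open Scope classical_set_scope.
Local Open Scope ring_scope.

Theorem theorem1p2 (R : realType) (d : nat) (hd : (2 <= d)%N) :
  exists eps : nat -> R,
    eps n @[n --> \oo] --> (0 : R) /\
    let t (n : nat) : R := (1 + eps n) * (n%:R * ln n%:R / 2) in
    let b (n : nat) : R := (1 + eps n) * (d%:R * n%:R / 2) in
    exists sigma : forall n : nat, strategy R n,
      (forall n : nat, (0 < n)%N -> is_tb_strategy (t n) (b n) (sigma n)) /\
      prob_graph (sigma n) (Num.truncn (t n)) (d_connected d)
        @[n --> \oo] --> (1 : R).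
Proof.
pose ek (k : nat) : R := k.+1%:R^-1.
have ek0 k : 0 < ek k by rewrite invr_gt0.
have ek1 k : ek k <= 1 by rewrite invf_le1 // ler1n.
have [n0 Hn0] := boolp.choice (fun k => good_rule hd (ek0 k) (ek1 k)).
pose I n := [set k : 'I_n | (n0 k <= n)%N]%SET.
pose kap n := (\max_(k in I n) k)%N.
pose eps n : R := if I n == set0 then 1 else ek (kap n).
have eps0 n : 0 <= eps n by rewrite /eps; case: ifP => // _; exact: ltW.
have epsk k n : (maxn k.+1 (n0 k) <= n)%N -> I n != set0 /\ eps n <= ek k.
  rewrite geq_max => /andP[kn n0n].
  have kI : Ordinal kn \in I n by rewrite inE.
  have I0 : I n != set0 by apply/set0Pn; exists (Ordinal kn).
  split=> //; rewrite /eps (negbTE I0) /ek lef_pV2 ?posrE // ler_nat ltnS.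
  by rewrite /kap; apply: (bigop.bigmax_sup (Ordinal kn)).
have rules n : exists f : seq (edge n) -> bool,
    (forall (o : seq (edge n)) (s : nat), uniq o ->
       #|accepted f o s|%:R <= (1 + eps n) * (d%:R * n%:R / 2)) /\
    (I n != set0 -> 1 - eps n <= Pr R (fun o => d_connected d
       (adj (accepted f o (Num.truncn ((1 + eps n) * (n%:R * ln n%:R / 2))))))).
  have [I0|I0] := eqVneq (I n) set0.
    exists (fun=> false); split=> // o s uo.
    rewrite (_ : accepted _ _ _ = set0); last first.
      by apply/setP => e; rewrite !inE andbF.
    by rewrite cards0 !mulr_ge0 ?invr_ge0 // addr_ge0.
  have cI : (0 < #|I n|)%N by rewrite card_gt0.
  have [k0 k0I k0E] := eq_bigmax_cond (fun k : 'I_n => k : nat) cI.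
  have kn : (n0 (kap n) <= n)%N by rewrite /kap k0E; move: k0I; rewrite inE.
  have [f [f1 f2]] := Hn0 _ _ kn.
  by exists f; rewrite /eps (negbTE I0).
have ev (P : nat -> Prop) k : (forall n, (maxn k.+1 (n0 k) <= n)%N -> P n) ->
    \forall n \near \oo, P n.
  by move=> HP; exists (maxn k.+1 (n0 k)).
have eps_cvg : eps n @[n --> \oo] --> (0 : R).
  apply/cvgr0Pnorm_le => e e0; pose k := Num.truncn e^-1.
  apply: (ev _ k) => n /epsk[_ /le_trans]; rewrite ger0_norm //; apply.
  by rewrite /ek invf_ple ?posrE // ltW // -natr1 truncn_lt.
exists eps; split=> // t b.
pose f n := projT1 (cid (rules n)).
have Hf n : (forall (o : seq (edge n)) (s : nat), uniq o -> #|accepted (f n) o s|%:R <= b n) /\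
  (I n != set0 -> 1 - eps n <= Pr R (fun o => d_connected d
     (adj (accepted (f n) o (Num.truncn (t n)))))) by rewrite /f; case: cid.
exists (fun n => deterministic R (f n)); split=> [n _ w o s | ].
  by rewrite inE => uo _; apply: (proj1 (Hf n)).
apply: (@squeeze_cvgr _ _ _ _ (fun n => 1 - eps n) (fun=> 1)).
- apply: (ev _ 0%N) => n /epsk[I0 _]; rewrite prob_deterministic.
  by rewrite (proj2 (Hf n)) //= Pr_le1.
- rewrite -[X in _ --> X]subr0; apply: cvgB => //; exact: cvg_cst.
- exact: cvg_cst.
Qed.
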